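(* If a smooth projective curve $C/k$ carries a point $P$ having a Weierstrass semi-group of embedding dimension $2$, then this semi-group does not depend on the choice of $P$; that is, if $P$ and $P'$ are points of $C$ whose Weierstrass semi-groups both have embedding dimension $2$, then these two semi-groups are equal.
   Context: $k$ is an algebraically closed field of characteristic zero. The Weierstrass semi-group of a point $P$ on a smooth projective curve $C$ is the set of possible pole orders at $P$ of functions that are regular on $C\setminus\{P\}$; it is a numerical semi-group, i.e. a sub-semi-group of $\mathbb{N}$ with finite complement. A numerical semi-group has embedding dimension $2$ if it is of the form $a\mathbb{N}+b\mathbb{N}$ for coprime integers $a,b\ge2$. Curves are irreducible. *)

(* Defs.v *)
From mathcomp Require Export all_boot all_order all_algebra.
From mathcomp Require Export classical_sets.
From mathcomp Require Export mpoly.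

Set Implicit Arguments.
Unset Strict Implicit.
Unset Printing Implicit Defensive.

Import GRing.Theory.

Local Open Scope classical_set_scope.
Local Open Scope ring_scope.

(* P^n(k), as the set of lines through the origin of k^(n+1). *)
Definition projspace (k : fieldType) (n : nat) : Type :=
  {L : {vspace 'rV[k]_n.+1} | \dim L == 1%N}.

Section ProjectiveSets.

Variables (k : fieldType) (n : nat).
Implicit Types (p : {mpoly k[n.+1]}) (P : projspace k n).
Implicit Types (C Z : set (projspace k n)).

Definition homogeneous p : Prop := exists d : nat, p \is d.-homog.

(* All representatives of P are tested, so that for p not homogeneous this
   means that every homogeneous component of p vanishes at P (k infinite). *)
Definition vanishes_at p P : Prop :=
  forall v : 'rV[k]_n.+1, v \in val P -> p.@[v ord0] = 0.

Definition vanishing_ideal C : set {mpoly k[n.+1]} :=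
  [set p | forall P, C P -> vanishes_at p P].

Definition zariski_closed Z : Prop :=
  exists S : set {mpoly k[n.+1]},
    (forall p, S p -> homogeneous p) /\
    Z = [set P | forall p, S p -> vanishes_at p P].

Definition zariski_irreducible Z : Prop :=
  Z !=set0 /\
  forall Z1 Z2, zariski_closed Z1 -> zariski_closed Z2 ->
    Z `<=` Z1 `|` Z2 -> Z `<=` Z1 \/ Z `<=` Z2.

Definition has_chain Z (d : nat) : Prop :=
  exists F : nat -> set (projspace k n),
    (forall i, (i <= d)%N ->
       [/\ zariski_closed (F i), zariski_irreducible (F i) & F i `<=` Z]) /\
    (forall i, (i < d)%N -> F i `<` F i.+1).

Definition has_dimension Z (d : nat) : Prop :=
  has_chain Z d /\ ~ has_chain Z d.+1.

Definition generate_ideal m (f : 'I_m -> {mpoly k[n.+1]})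
    (I : set {mpoly k[n.+1]}) : Prop :=
  forall p, I p <->
    exists c : 'I_m -> {mpoly k[n.+1]}, p = \sum_(i < m) c i * f i.

Definition jacobian m (f : 'I_m -> {mpoly k[n.+1]}) (v : 'rV[k]_n.+1) :
    'M[k]_(m, n.+1) :=
  \matrix_(i < m, j < n.+1) (mderiv j (f i)).@[v ord0].

(* Jacobian criterion in homogeneous coordinates: the rank is the codimension
   n - d of Z in P^n. *)
Definition smooth_of_dim Z (d : nat) : Prop :=
  exists m (f : 'I_m -> {mpoly k[n.+1]}),
    [/\ forall i, homogeneous (f i),
        generate_ideal f (vanishing_ideal Z) &
        forall P, Z P -> forall v : 'rV[k]_n.+1, v \in val P -> v != 0 ->
          (\rank (jacobian f v) + d)%N = n].

Definition smooth_projective_curve C : Prop :=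
  [/\ zariski_closed C, zariski_irreducible C,
      has_dimension C 1 & smooth_of_dim C 1].

(* A rational function on C is represented by a fraction phi.1 / phi.2 of
   homogeneous polynomials of the same degree, up to frac_eq C. *)
Definition frac : Type := ({mpoly k[n.+1]} * {mpoly k[n.+1]})%type.

Implicit Types (phi psi t : frac).

Definition rational_on C phi : Prop :=
  (exists d : nat, phi.1 \is d.-homog /\ phi.2 \is d.-homog) /\
  ~ vanishing_ideal C phi.2.

Definition frac_eq C phi psi : Prop :=
  vanishing_ideal C (phi.1 * psi.2 - psi.1 * phi.2).

Definition frac_mul phi psi : frac := (phi.1 * psi.1, phi.2 * psi.2).

Definition frac_exp phi (m : nat) : frac := (phi.1 ^+ m, phi.2 ^+ m).

(* phi belongs to the local ring of C at P *)
Definition regular_at C P phi : Prop :=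
  rational_on C phi /\
  exists psi, [/\ rational_on C psi, frac_eq C phi psi &
                  ~ vanishes_at psi.2 P].

(* phi belongs to the maximal ideal of the local ring of C at P *)
Definition zero_at C P phi : Prop :=
  rational_on C phi /\
  exists psi, [/\ rational_on C psi, frac_eq C phi psi,
                  ~ vanishes_at psi.2 P & vanishes_at psi.1 P].

Definition uniformizer C P t : Prop :=
  zero_at C P t /\
  forall phi, zero_at C P phi ->
    exists2 psi, regular_at C P psi & frac_eq C phi (frac_mul t psi).

(* m = max(0, - v_P(phi)): phi * t^m is regular at P and, when m > 0, a unit. *)
Definition has_pole_order C P phi (m : nat) : Prop :=
  exists t, [/\ uniformizer C P t,
    regular_at C P (frac_mul phi (frac_exp t m)) &
    (0 < m)%N -> ~ zero_at C P (frac_mul phi (frac_exp t m))].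

Definition weierstrass_semigroup C P : set nat :=
  [set m | exists phi,
     [/\ rational_on C phi,
         forall Q, C Q -> Q <> P -> regular_at C Q phi &
         has_pole_order C P phi m]].

End ProjectiveSets.

Definition embedding_dim_two (H : set nat) : Prop :=
  exists a b : nat,
    [/\ (2 <= a)%N, (2 <= b)%N, coprime a b &
        H = [set m | exists i j : nat, m = (a * i + b * j)%N]].

(* Main.v *)
From HB Require Import structures.
Require Import Defs.
From mathcomp Require Import boolp zify ring lra.

(** Let P and P' be distinct points with semi-groups aN + bN and a'N + b'N,
    where a < b and a' < b'.  Both semi-groups are read off from the ring R of
    functions regular outside P and P' and from the orders v, v' of functions
    at P and P', and the theorem is a formal consequence of the properties of
    (R, v, v').  A numerical semi-group generated by a and b is determined by
    its smaller generator a and by its number of gaps (a - 1)(b - 1) / 2, and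
    both numbers are the same at the two points.

    Number of gaps ([gap_number_le]).  Every integer is the order at P of some
    function in R ([all_values]).  To a gap m at P one assigns the least pole
    order at P' among the functions of R with pole order m at P.  This is a
    gap at P', and the assignment is injective.

    Smaller generator ([pole_order_lower_bound]).  The functions regular
    outside P form the ring k[x, y], with x and y of pole orders a and b; so
    one of x - x(P'), y - y(P') is a local parameter l at P', of pole order at
    most b at P.  If some f with its only pole at P' had pole order d < a,
    then h = l ^ (d - 1) f would have a simple pole at P' and a pole of order
    at most (a - 2) b at P, which is less than the Frobenius number
    F = ab - a - b.  No such h exists ([no_simple_pole]), because the
    semi-group at P is symmetric: after subtracting functions regular outside
    P, the pole order o of h at P may be taken to be a gap; then F - o is a
    pole order at P, and a function w with this pole order which vanishes at
    P' gives a function h w regular outside P whose pole order is the gap F.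
    So a <= a', and by symmetry a = a'.

    It remains to obtain v and v'.  The function field K is the quotient of
    the homogeneous fractions of degree 0 by equality on the curve; it is a
    field because the curve is irreducible.  The definition of the semi-group
    provides a uniformizer t at P, that is, a generator of the maximal ideal
    of the local ring.  That every nonzero function is a unit times a power of
    t is Krull's intersection theorem ([local_factor]); it rests on the
    Hilbert basis theorem ([hilbert_basis]), carried over to the local ring by
    dehomogenization ([local_ring_noether]). *)

Set Implicit Arguments.
Unset Strict Implicit.
Unset Printing Implicit Defensive.

Import Order.TTheory GRing.Theory Num.Theory.
Local Open Scope quotient_scope.
Local Open Scope ring_scope.

(** * Semi-groups generated by two coprime integers *)

Definition two_gen (a b : nat) (z : int) : Prop :=
  exists i j : nat, z = (a * i + b * j)%N%:Z.

Definition frobenius (a b : nat) : int := a%:Z * b%:Z - a%:Z - b%:Z.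

Lemma two_genC a b z : two_gen a b z -> two_gen b a z.
Proof. by move=> [i [j ->]]; exists j, i; rewrite addnC. Qed.

(** The semi-group generated by two coprime integers is symmetric about half
    its Frobenius number.  By Bezout every integer z is a * i + b * j with
    0 <= j < a; if z is a gap then i < 0, and reflecting z turns the
    coefficients i, j into the nonnegative ones -1 - i, a - 1 - j. *)
Lemma two_gen_symmetric a b (z : int) : (0 < a)%N -> (0 < b)%N -> coprime a b ->
  ~ two_gen a b z -> two_gen a b (frobenius a b - z).
Proof.
move=> a0 b0 co nz.
have [u [w uw]] : exists u w : int, u * a%:Z + w * b%:Z = 1.
  have := Bezoutz a%:Z b%:Z; rewrite /gcdz /=.
  by move: co; rewrite /coprime => /eqP -> [u [w h]]; exists u, w.
pose j := ((w * z) %% a%:Z)%Z.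
pose q := ((w * z) %/ a%:Z)%Z.
have wz : w * z = q * a%:Z + j by apply: divz_eq.
have j0 : 0 <= j by apply: modz_ge0; lia.
have ja : j < a%:Z by apply: ltz_pmod; lia.
pose i := u * z + b%:Z * q.
have zE : z = a%:Z * i + b%:Z * j.
  have -> : j = w * z - q * a%:Z by rewrite wz; ring.
  rewrite /i -[LHS]mul1r -uw; ring.
have [i0|i0] := leP 0 i.
  case: nz; exists `|i|%N, `|j|%N.
  by rewrite zE PoszD !PoszM !gez0_abs.
pose i1 : int := - 1 - i; pose j1 : int := a%:Z - 1 - j.
exists (absz i1), (absz j1).
rewrite PoszD !PoszM !gez0_abs /i1 /j1; try lia.
by rewrite /frobenius zE; ring.
Qed.

Lemma frobenius_gap a b : (0 < a)%N -> (0 < b)%N -> coprime a b ->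
  ~ two_gen a b (frobenius a b).
Proof.
move=> a0 b0 co [i [j]]; rewrite /frobenius => h.
have {}h : (a * b = a * i.+1 + b * j.+1)%N by lia.
have aj : (a %| j.+1)%N.
  rewrite -(Gauss_dvdr _ co) -(@dvdn_addr (a * i.+1)) ?dvdn_mulr //.
  by rewrite -h dvdn_mulr.
have bi : (b %| i.+1)%N.
  rewrite coprime_sym in co.
  rewrite -(Gauss_dvdr _ co) -(@dvdn_addl (b * j.+1)) ?dvdn_mulr //.
  by rewrite -h dvdn_mull.
move/dvdnP: aj => [q qE]; move/dvdnP: bi => [p pE].
have := h; rewrite qE pE.
have q0 : (0 < q)%N by case: q qE.
have p0 : (0 < p)%N by case: p pE.
nia.
Qed.

Lemma two_gen_large a b (z : int) : (0 < a)%N -> (0 < b)%N -> coprime a b ->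
  frobenius a b < z -> two_gen a b z.
Proof.
move=> a0 b0 co hz; case: (pselect (two_gen a b z)) => // nz.
have [i [j]] := two_gen_symmetric a0 b0 co nz; lia.
Qed.

Lemma frobenius_gt0 a b : (2 <= a)%N -> (2 <= b)%N -> coprime a b ->
  0 < frobenius a b.
Proof.
move=> a2 b2 co; rewrite /frobenius.
have : a <> b by move=> e; move: co; rewrite e /coprime gcdnn; lia.
nia.
Qed.

(** All gaps are at most the Frobenius number, so the index set loses none. *)
Definition gap_number (a b : nat) : nat :=
  #|[set i : 'I_(absz (frobenius a b)).+1 | ~~ `[< two_gen a b (nat_of_ord i)%:Z >] ]|.

(** The reflection z |-> frobenius - z exchanges gaps and non-gaps. *)
Lemma gap_numberE a b : (2 <= a)%N -> (2 <= b)%N -> coprime a b ->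
  (gap_number a b).*2 = (absz (frobenius a b)).+1.
Proof.
move=> a2 b2 co; have F0 := frobenius_gt0 a2 b2 co.
have a0 : (0 < a)%N by lia.
have b0 : (0 < b)%N by lia.
rewrite /gap_number -sum1_card big_mkcond /=.
set F := absz _; pose gap (i : nat) := ~~ `[< two_gen a b i%:Z >].
have -> : (\sum_(i < F.+1) (if i \in
      [set i : 'I_F.+1 | ~~ `[< two_gen a b (nat_of_ord i)%:Z >] ] then 1 else 0)
    = \sum_(i < F.+1) gap i)%N.
  by apply: eq_bigr => i _; rewrite inE /gap; case: asboolP.
rewrite -addnn {2}(reindex_inj rev_ord_inj) -big_split /=.
rewrite (eq_bigr (fun=> 1%N)) ?sum1_card ?card_ord // => i _.
have iF : (i <= F)%N by rewrite -ltnS.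
have FE : frobenius a b = F%:Z by rewrite /F gez0_abs // ltW.
rewrite subSS /gap; case: asboolP => h1; case: asboolP => h2 //.
  case: h1 => i1 [j1 h1]; case: h2 => i2 [j2 h2].
  case: (frobenius_gap a0 b0 co); exists (i1 + i2)%N, (j1 + j2)%N.
  rewrite FE; lia.
case: h2; have := two_gen_symmetric a0 b0 co h1.
by rewrite FE subzn.
Qed.

(** * Valuations with residue field k *)

(** A valuation is only meaningful away from 0; this predicate gives 0 the
    order +oo, which spares the case distinctions. *)
Definition order_ge (K : fieldType) (v : K -> int) (m : int) (f : K) : bool :=
  (f == 0) || (m <= v f).

Record residual_valuation (k K : fieldType) (c : {rmorphism k -> K})
    (v : K -> int) : Prop := ResidualValuation {
  valuationM : forall f g, f != 0 -> g != 0 -> v (f * g) = v f + v g;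
  valuationD : forall m f g,
    order_ge v m f -> order_ge v m g -> order_ge v m (f + g);
  valuation_const : forall x, x != 0 -> v (c x) = 0;
  valuation_residue : forall f g, f != 0 -> g != 0 -> v f = v g ->
    exists x, order_ge v (v f + 1) (f - c x * g) }.

Section OneValuation.

Variables (k K : fieldType) (c : {rmorphism k -> K}) (v : K -> int).
Hypothesis hv : residual_valuation c v.
Implicit Types (f g : K) (x : k) (m : int).

Lemma order_geE m f : f != 0 -> order_ge v m f = (m <= v f).
Proof. by rewrite /order_ge => /negPf ->. Qed.

Lemma order_ge_self f : order_ge v (v f) f.
Proof. by rewrite /order_ge lexx orbT. Qed.

Lemma order_ge_le m n f : m <= n -> order_ge v n f -> order_ge v m f.
Proof. by rewrite /order_ge => mn /orP[->//|h]; rewrite (le_trans mn h) orbT. Qed.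

Lemma order_geM m n f g :
  order_ge v m f -> order_ge v n g -> order_ge v (m + n) (f * g).
Proof.
rewrite {1 2}/order_ge.
have [->|f0] := eqVneq f 0; first by rewrite mul0r /order_ge eqxx.
have [->|g0] := eqVneq g 0; first by rewrite mulr0 /order_ge eqxx.
by rewrite /= order_geE ?mulf_neq0 // (valuationM hv) // => *; apply: lerD.
Qed.

Lemma order_ge_const x : order_ge v 0 (c x).
Proof.
have [->|x0] := eqVneq x 0; first by rewrite rmorph0 /order_ge eqxx.
by rewrite /order_ge (valuation_const hv) // lexx orbT.
Qed.

Lemma order_geMc m x f : order_ge v m f -> order_ge v m (c x * f).
Proof. by rewrite -{2}[m]add0r; apply: order_geM; apply: order_ge_const. Qed.

Lemma order_geN m f : order_ge v m f -> order_ge v m (- f).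
Proof. by move/(order_geMc (- 1)); rewrite rmorphN1 mulN1r. Qed.

Lemma order_geB m f g : order_ge v m f -> order_ge v m g -> order_ge v m (f - g).
Proof. by move=> hf hg; apply: (valuationD hv) => //; apply: order_geN. Qed.

Lemma order_ge1 : order_ge v 0 1.
Proof. by rewrite -(rmorph1 c) order_ge_const. Qed.

Lemma valuation1 : v 1 = 0.
Proof. by rewrite -(rmorph1 c) (valuation_const hv) ?oner_neq0. Qed.

Lemma valuationX f n : f != 0 -> v (f ^+ n) = n%:Z * v f.
Proof.
move=> f0; elim: n => [|n IH]; first by rewrite expr0 valuation1 mul0r.
by rewrite exprS (valuationM hv) ?expf_neq0 // IH; lia.
Qed.

Lemma order_geX m f n : order_ge v m f -> order_ge v (n%:Z * m) (f ^+ n).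
Proof.
move=> h; elim: n => [|n IH]; first by rewrite expr0 mul0r order_ge1.
by rewrite exprS (_ : n.+1%:Z * m = m + n%:Z * m) ?order_geM //; lia.
Qed.

Lemma valuation_dominant f g : f != 0 -> order_ge v (v f + 1) g ->
  f + g != 0 /\ v (f + g) = v f.
Proof.
move=> f0 hg; have fg0 : f + g != 0.
  apply/eqP => e; move: hg; rewrite (_ : g = - f); last by apply/eqP; rewrite -addr_eq0 addrC e.
  move/order_geN; rewrite opprK order_geE //; lia.
have h1 : v f <= v (f + g).
  rewrite -order_geE //; apply: (valuationD hv) (order_ge_self _) _.
  by apply: order_ge_le hg; lia.
split=> //; apply/eqP; rewrite eq_le h1 andbT leNgt; apply/negP => h2.
have : order_ge v (v f + 1) f.
  rewrite -[f in order_ge v _ f](addrK g) order_geB //.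
  by apply: (@order_ge_le _ (v (f + g))); [move: h2; lia|apply: order_ge_self].
by rewrite order_geE //; lia.
Qed.

Lemma residueP f : order_ge v 0 f -> exists x, order_ge v 1 (f - c x).
Proof.
have [->|f0] := eqVneq f 0.
  by exists 0; rewrite rmorph0 subr0 /order_ge eqxx.
rewrite order_geE // le_eqVlt => /orP[/eqP h|h]; last first.
  by exists 0; rewrite rmorph0 subr0 order_geE //; lia.
have [|x] := valuation_residue hv f0 (oner_neq0 _); first by rewrite valuation1.
by rewrite -h add0r mulr1; exists x.
Qed.

End OneValuation.

(** * Two places and the functions regular elsewhere

    R plays the ring of functions regular outside two points, at which the
    orders are v and v'. *)

Record place_pair (k K : fieldType) (c : {rmorphism k -> K})
    (v v' : K -> int) (R : K -> Prop) : Prop := PlacePair {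
  pair_fst : residual_valuation c v;
  pair_snd : residual_valuation c v';
  pair_const : forall x, R (c x);
  pairD : forall f g, R f -> R g -> R (f + g);
  pairM : forall f g, R f -> R g -> R (f * g) }.

(** Restricted to positive m because a pole order 0 also stands for functions
    that vanish at the first place, where v is positive. *)
Definition pole_semigroup (K : fieldType) (v v' : K -> int) (R : K -> Prop)
    (a b : nat) : Prop :=
  forall m : nat, (0 < m)%N -> two_gen a b m%:Z <->
    exists f, [/\ R f, f != 0, order_ge v' 0 f & v f = - m%:Z].

Lemma place_pair_sym (k K : fieldType) (c : {rmorphism k -> K}) v v' R :
  place_pair c v v' R -> place_pair c v' v R.
Proof. by case=> *; split. Qed.

Section TwoPlaces.

Variables (k K : fieldType) (c : {rmorphism k -> K}) (v v' : K -> int).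
Variable (R : K -> Prop).
Hypothesis hR : place_pair c v v' R.
Implicit Types (f g h : K).

Let hv := pair_fst hR.
Let hv' := pair_snd hR.

Lemma pairB f x g : R f -> R g -> R (f - c x * g).
Proof.
move=> hf hg; apply: (pairD hR) => //; rewrite -mulN1r mulrA.
rewrite -(rmorphN1 c) -rmorphM; apply: (pairM hR) => //; exact: (pair_const hR).
Qed.

Lemma pairX f n : R f -> R (f ^+ n).
Proof.
move=> hf; elim: n => [|n IH]; last by rewrite exprS; apply: (pairM hR).
by rewrite expr0 -(rmorph1 c); apply: (pair_const hR).
Qed.

(** The values of v on R form a sub-semi-group of the integers.  It contains
    all sufficiently negative integers, since the gaps at the first place are
    finitely many, and a positive one, because the pole orders at the second
    place give a non-constant function regular at the first.  Such a
    sub-semi-group is everything.  This replaces Riemann-Roch. *)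
Lemma all_values a b a' b' :
  (0 < a)%N -> (0 < b)%N -> coprime a b -> (0 < a')%N ->
  pole_semigroup v v' R a b -> pole_semigroup v' v R a' b' ->
  forall z : int, exists f, [/\ R f, f != 0 & v f = z].
Proof.
move=> a0 b0 co a'0 hS hS' z.
have [u [Ru u0 vu]] : exists u, [/\ R u, u != 0 & 0 < v u].
  have /(hS' a' a'0)[f [Rf f0 vf v'f]] : two_gen a' b' a'%:Z.
    by exists 1%N, 0%N; lia.
  have [x hx] := residueP hv vf.
  exists (f - c x); have fx0 : f - c x != 0.
    apply/eqP => /subr0_eq e; move: v'f.
    have x0 : x != 0 by apply/eqP => x0; rewrite e x0 rmorph0 eqxx in f0.
    by rewrite e (valuation_const hv') //; lia.
  split=> //; last by move: hx; rewrite order_geE //; lia.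
  by rewrite -[c x]mulr1 -(rmorph1 c); apply: pairB => //; apply: (pair_const hR).
(* With this many factors u, the pole order of the cofactor exceeds the
   Frobenius number. *)
pose F := absz (frobenius a b); pose j := (F + absz z).+1.
have hj : frobenius a b < j%:Z * v u - z by rewrite /j /F; nia.
have hj0 : 0 < j%:Z * v u - z by rewrite /j /F; nia.
have [m mE] : exists m : nat, m%:Z = j%:Z * v u - z.
  by move: (j%:Z * v u - z) hj0 => w w0; exists (absz w); rewrite gez0_abs // ltW.
have m0 : (0 < m)%N by lia.
have /(hS m m0)[f [Rf f0 _ vf]] : two_gen a b m%:Z.
  by apply: two_gen_large; rewrite ?mE.
exists (f * u ^+ j); split; [by apply: (pairM hR) => //; apply: pairX|by rewrite mulf_neq0 ?expf_neq0|].
by rewrite (valuationM hv) ?expf_neq0 // (valuationX hv) // vf mE; ring.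
Qed.

(** Multiplying by a power of such an f would lower any large pole order to 1,
    which is a gap. *)
Lemma regular_zero_eq0 a b f : (2 <= a)%N -> (2 <= b)%N -> coprime a b ->
  pole_semigroup v v' R a b ->
  R f -> order_ge v' 0 f -> order_ge v 1 f -> f = 0.
Proof.
move=> a2 b2 co hS Rf f' vf; apply/eqP/negPn/negP => f0.
move: vf; rewrite order_geE // => vf.
pose F := absz (frobenius a b); pose N := F.+1.
have [||g [Rg g0 g' vg]] := (hS (1 + N * absz (v f))%N _).1.
- by lia.
- by apply: two_gen_large => //; rewrite ?(ltnW a2) ?(ltnW b2) // /N /F; nia.
have [] := (hS 1%N isT).2; last first.
  move=> i [j] e; have {e} : (1 = a * i + b * j)%N by lia.
  by case: i => [|i]; case: j => [|j]; nia.
exists (g * f ^+ N); split.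
- by apply: (pairM hR) => //; apply: pairX.
- by rewrite mulf_neq0 ?expf_neq0.
- rewrite -[0]addr0; apply: (order_geM hv') => //.
  by rewrite -[0](mulr0 N%:Z); apply: (order_geX hv').
- rewrite (valuationM hv) ?expf_neq0 // (valuationX hv) // vg.
  by rewrite PoszD PoszM gez0_abs ?ltW //; ring.
Qed.


Section OneSemigroup.

Variables a b : nat.
Hypotheses (a2 : (2 <= a)%N) (b2 : (2 <= b)%N) (co : coprime a b).
Hypothesis hS : pole_semigroup v v' R a b.

(** The ring of functions regular outside the first place is k[x, y], where x
    and y have pole orders a and b there: a monomial in x and y cancels the
    leading term of f, until f has no pole and is constant. *)
Lemma regular_ind (P : K -> Prop) x y :
    R x -> order_ge v' 0 x -> x != 0 -> v x = - a%:Z ->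
    R y -> order_ge v' 0 y -> y != 0 -> v y = - b%:Z ->
    (forall z, P (c z)) ->
    (forall f g, P f -> P g -> P (f + g)) ->
    (forall f g, P f -> P g -> P (f * g)) ->
    P x -> P y ->
  forall f, R f -> order_ge v' 0 f -> P f.
Proof.
move=> Rx x' x0 vx Ry y' y0 vy Pc PD PM Px Py.
have PX f n : P f -> P (f ^+ n).
  move=> Pf; elim: n => [|n IH]; last by rewrite exprS; apply: PM.
  by rewrite expr0 -(rmorph1 c).
suff main n f : R f -> order_ge v' 0 f -> order_ge v (- n%:Z) f -> P f.
  move=> f Rf f'; apply: (main (absz (v f))) => //.
  by apply: order_ge_le (order_ge_self v f); lia.
elim: n f => [|n IH] f Rf f' vf.
  rewrite oppr0 in vf; have [z hz] := residueP hv vf.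
  suff /subr0_eq -> : f - c z = 0 by [].
  have Rz := pair_const hR.
  apply: (regular_zero_eq0 a2 b2 co hS) => //.
    by rewrite -[c z]mulr1 -(rmorph1 c); apply: pairB.
  by apply: (order_geB hv') => //; apply: (order_ge_const hv').
have [/IH|nvf] := boolP (order_ge v (- n%:Z) f); first exact.
have f0 : f != 0 by apply: contraNneq nvf => ->; rewrite /order_ge eqxx.
have fE : v f = - n.+1%:Z by move: vf nvf; rewrite !order_geE //; lia.
have [i [j ij]] : two_gen a b n.+1%:Z by apply/(hS (ltn0Sn n)); exists f.
pose g := x ^+ i * y ^+ j.
have g0 : g != 0 by rewrite mulf_neq0 ?expf_neq0.
have vg : v f = v g.
  rewrite (valuationM hv) ?expf_neq0 // !(valuationX hv) // vx vy fE ij.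
  by rewrite PoszD !PoszM; ring.
have [z hz] := valuation_residue hv f0 g0 vg.
have Pg : P g by apply: PM; apply: PX.
rewrite -(subrK (c z * g) f); apply: (PD); last by apply: PM.
apply: IH.
- by apply: pairB => //; apply: (pairM hR); apply: pairX.
- apply: (order_geB hv') => //; apply: (order_geMc hv').
  rewrite -[0]addr0; apply: (order_geM hv').
    by rewrite -[0](mulr0 i%:Z); apply: (order_geX hv').
  by rewrite -[0](mulr0 j%:Z); apply: (order_geX hv').
- by apply: order_ge_le hz; rewrite fE; lia.
Qed.

(** One of x - x(P'), y - y(P') is a local parameter at the second place P':
    otherwise k[x, y] would contain no function of order 1 there. *)
Lemma exists_parameter : (a <= b)%N ->
  (exists u, [/\ R u, u != 0 & v' u = 1]) ->
  exists l, [/\ R l, l != 0, v' l = 1 & order_ge v (- b%:Z) l].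
Proof.
move=> ab [u [Ru u0 v'u]]; apply: contrapT => none.
have gen m : (0 < m <= b)%N -> two_gen a b m%:Z ->
    exists f, [/\ R f, order_ge v' 0 f, f != 0, v f = - m%:Z &
      exists z, order_ge v' 2 (f - c z)].
  move=> /andP[m0 mb] /(hS m0)[f [Rf f0 f' vf]].
  exists f; split=> //; have [z hz] := residueP hv' f'.
  exists z; apply/negPn/negP => hn; apply: none; exists (f - c z); split.
  - rewrite -[c z]mulr1 -(rmorph1 c); apply: pairB => //; exact: (pair_const hR).
  - by apply: contraNneq hn => ->; rewrite /order_ge eqxx.
  - have f1 : f - c z != 0 by apply: contraNneq hn => ->; rewrite /order_ge eqxx.
    by move: hz hn; rewrite !order_geE //; lia.
  - apply: (order_geB hv); first by rewrite order_geE // vf; lia.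
    by apply: order_ge_le (order_ge_const hv _); lia.
have [||x [Rx x' x0 vx Px]] := gen a; [by lia|by exists 1%N, 0%N; lia|].
have [||y [Ry y' y0 vy Py]] := gen b; [by lia|by exists 0%N, 1%N; lia|].
pose P f := exists z, order_ge v' 2 (f - c z).
have P0 f : P f -> order_ge v' 0 f.
  case=> z hz; rewrite -(subrK (c z) f); apply: (valuationD hv').
    by apply: order_ge_le hz.
  exact: (order_ge_const hv').
have [z hz] : P u.
  apply: (regular_ind Rx x' x0 vx Ry y' y0 vy) => //.
  - by move=> z; exists z; rewrite subrr /order_ge eqxx.
  - move=> f g [z hz] [w hw]; exists (z + w).
    by rewrite rmorphD opprD addrACA; apply: (valuationD hv').
  - move=> f g [z hz] Pg; have [w hw] := Pg; exists (z * w).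
    have -> : f * g - c (z * w) = (f - c z) * g + c z * (g - c w).
      by rewrite rmorphM; ring.
    apply: (valuationD hv'); last by apply: (order_geMc hv').
    by rewrite -[2]addr0; apply: (order_geM hv') => //; apply: P0.
  - by rewrite order_geE // v'u.
have [z0|z0] := eqVneq z 0.
  by move: hz; rewrite z0 rmorph0 subr0 order_geE // v'u.
have cz0 : c z != 0 by rewrite fmorph_eq0.
have := order_geB hv' (order_ge_le _ (order_ge_self v' u)) (order_ge_le _ hz).
move/(_ 1); rewrite v'u => /(_ (lexx _) isT).
by rewrite opprB addrC subrK order_geE // (valuation_const hv').
Qed.

(** Let o be the order of the pole of h at the first place.  If o is a gap,
    so that F - o is in the semi-group by symmetry, multiply h by a function
    with pole order F - o that vanishes at the second place: the product has
    no pole there and pole order F, which is a gap. *)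
Lemma simple_pole_order_in_semigroup h : R h -> h != 0 -> v' h = - 1 ->
  - v h < frobenius a b -> two_gen a b (- v h).
Proof.
have a0 : (0 < a)%N by lia.
have b0 : (0 < b)%N by lia.
have F0 := frobenius_gt0 a2 b2 co.
move=> Rh h0 v'h vh; apply: contrapT => nh.
have := two_gen_symmetric a0 b0 co nh; rewrite opprK => hm.
have [m mE] : exists m : nat, m%:Z = frobenius a b + v h.
  by exists (absz (frobenius a b + v h)); rewrite gez0_abs //; lia.
have m0 : (0 < m)%N by lia.
rewrite -mE in hm; have [w [Rw w0 w' vw]] := (hS m0).1 hm.
have [z hz] := residueP hv' w'.
have [|w10 vw1] := valuation_dominant hv w0 (g := - c z).
  apply: (order_geN hv); apply: order_ge_le (order_ge_const hv _); lia.
have hF : (0 < absz (frobenius a b))%N by lia.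
apply: (frobenius_gap a0 b0 co); rewrite -[frobenius a b]gez0_abs; last by lia.
apply/(hS hF); exists (h * (w - c z)); split.
- apply: (pairM hR) => //; rewrite -[c z]mulr1 -(rmorph1 c).
  by apply: pairB => //; apply: (pair_const hR).
- by rewrite mulf_neq0.
- rewrite -[0](addNr 1); apply: (order_geM hv') => //.
  by rewrite order_geE // v'h.
- by rewrite (valuationM hv) // vw1 vw mE gez0_abs //; lia.
Qed.

(** In geometric terms, P' is a base point of the sum of P' and the canonical
    divisor (F - 1) P.  The pole order of h at P is in the semi-group, so it
    can be lowered by subtracting a function regular at P', which leaves the
    pole at P' simple.  Repeating this, one reaches a negative pole order,
    which is not in the semi-group. *)
Lemma no_simple_pole h : R h -> h != 0 -> v' h = - 1 ->
  order_ge v (1 - frobenius a b) h -> False.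
Proof.
have F0 := frobenius_gt0 a2 b2 co.
set F := frobenius a b in F0 *.
suff main n : n%:Z <= F -> forall h, R h -> h != 0 -> v' h = - 1 ->
    order_ge v (1 - n%:Z) h -> False.
  move=> Rh h0 v'h vh; apply: (main (absz F) _ h) => //; rewrite gez0_abs //; lia.
elim: n => [|n IH] nF {}h Rh h0 v'h vh.
all: have hh : two_gen a b (- v h) by
  apply: simple_pole_order_in_semigroup => //; move: vh; rewrite order_geE // -/F; lia.
  by case: hh => i [j]; move: vh; rewrite order_geE //; lia.
have [g [Rg g0 g' vg]] : exists g, [/\ R g, g != 0, order_ge v' 0 g & v h = v g].
  have [vh0|vh0] := eqVneq (v h) 0.
    exists 1; rewrite oner_neq0 (order_ge1 hv') (valuation1 hv); split=> //.
    by rewrite -(rmorph1 c); apply: (pair_const hR).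
  have hm : (0 < absz (v h))%N by lia.
  have hE : (absz (v h))%:Z = - v h by case: hh => i [j]; lia.
  rewrite -hE in hh; have [g [Rg g0 g' vg]] := (hS hm).1 hh.
  by exists g; split=> //; rewrite vg hE opprK.
have [z hz] := valuation_residue hv h0 g0 vg.
have [|h1 v'h1] := valuation_dominant hv' h0 (g := - (c z * g)).
  rewrite v'h; apply: (order_geN hv'); exact: (order_geMc hv').
apply: (IH _ (h - c z * g)) => //; first by lia.
+ exact: pairB.
+ by rewrite v'h1.
+ by apply: order_ge_le hz; move: vh; rewrite order_geE //; lia.
Qed.

(** The analogue of computing the gonality.  If f had a pole of order d < a at
    P', then l ^+ (d - 1) * f, with l a local parameter at P' of pole order at
    most b at P, would have a simple pole at P' and at P a pole of order at
    most (a - 2) * b <= F - 1. *)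
Lemma pole_order_lower_bound f : (a < b)%N ->
  (exists u, [/\ R u, u != 0 & v' u = 1]) ->
  R f -> f != 0 -> order_ge v 0 f -> v' f < 0 -> v' f <= - a%:Z.
Proof.
move=> ab hu Rf f0 vf v'f; rewrite leNgt; apply/negP => af.
have [l [Rl l0 v'l vl]] := exists_parameter (ltnW ab) hu.
pose n := (absz (v' f)).-1.
apply: (@no_simple_pole (l ^+ n * f)).
- by apply: (pairM hR) => //; apply: pairX.
- by rewrite mulf_neq0 ?expf_neq0.
- by rewrite (valuationM hv') ?expf_neq0 // (valuationX hv') // v'l /n; lia.
- apply: order_ge_le (order_geM hv (order_geX hv n vl) vf).
  have na : (n.+1 < a)%N by lia.
  by rewrite /frobenius; nia.
Qed.

(** A gap m at P is sent to the least pole order m' at P' of the functions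
    with pole order m at P; if m' were the pole order of a function regular at
    P, subtracting a multiple of it would contradict minimality. *)
Lemma gap_partner a' b' (m : nat) :
  pole_semigroup v' v R a' b' ->
  (forall z : int, exists f, [/\ R f, f != 0 & v f = z]) ->
  ~ two_gen a b m%:Z -> exists m' : nat,
  [/\ ~ two_gen a' b' m'%:Z,
     exists f, [/\ R f, f != 0, v f = - m%:Z & v' f = - m'%:Z] &
     forall g, R g -> g != 0 -> v g = - m%:Z -> v' g <= - m'%:Z].
Proof.
move=> hS' hval nm.
have m0 : (0 < m)%N by case: m nm => // -[]; exists 0%N, 0%N; lia.
have neg g : R g -> g != 0 -> v g = - m%:Z -> v' g < 0.
  move=> Rg g0 vg; rewrite ltNge; apply/negP => g'; apply: nm; apply/(hS m0).
  by exists g; rewrite order_geE.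
pose Q (m' : nat) := `[< exists f, [/\ R f, f != 0, v f = - m%:Z & v' f = - m'%:Z] >].
have exQ : exists m', Q m'.
  have [f [Rf f0 vf]] := hval (- m%:Z); exists (absz (v' f)); apply/asboolP.
  by exists f; split=> //; have := neg f Rf f0 vf; lia.
pose m' := ex_minn exQ.
have [f [Rf f0 vf v'f]] : exists f, [/\ R f, f != 0, v f = - m%:Z & v' f = - m'%:Z].
  by rewrite /m'; case: ex_minnP => ? /asboolP.
have min g : R g -> g != 0 -> v g = - m%:Z -> v' g <= - m'%:Z.
  move=> Rg g0 vg; have g'0 := neg g Rg g0 vg.
  rewrite /m'; case: ex_minnP => n _ /(_ (absz (v' g))) hn.
  suff : (n <= absz (v' g))%N by lia.
  by apply: hn; apply/asboolP; exists g; split=> //; lia.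
clearbody m'.
exists m'; split=> //; last by exists f.
have m'0 : (0 < m')%N by have := neg f Rf f0 vf; lia.
move=> /(hS' _ m'0)[g [Rg g0 vg v'g]].
have [|z hz] := valuation_residue hv' f0 g0; first by rewrite v'f.
have [|h1 vh] := valuation_dominant hv f0 (g := - (c z * g)).
  apply: (order_geN hv); apply: (order_geMc hv).
  by apply: order_ge_le vg; rewrite vf; lia.
have := min (f - c z * g) (pairB z Rf Rg) h1; rewrite vh => /(_ vf).
move: hz; rewrite order_geE // v'f => hz hz2; have := le_trans hz hz2; lia.
Qed.

(** The map of the previous lemma is injective: of two gaps m < n with the same
    partner, subtracting the functions realizing them would give a function
    with pole order n at P and a smaller pole at P'.  Hence the genus, seen
    as the number of gaps, is the same at both points. *)
Lemma gap_number_le a' b' :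
  (2 <= a')%N -> (2 <= b')%N -> coprime a' b' ->
  pole_semigroup v' v R a' b' -> (gap_number a b <= gap_number a' b')%N.
Proof.
move=> a'2 b'2 co' hS'.
have a0 : (0 < a)%N by lia.
have b0 : (0 < b)%N by lia.
have a'0 : (0 < a')%N by lia.
have b'0 : (0 < b')%N by lia.
have hval := all_values a0 b0 co a'0 hS hS'.
have /choice[s hs] : forall m : nat, exists m' : nat, ~ two_gen a b m%:Z ->
  [/\ ~ two_gen a' b' m'%:Z,
     exists f, [/\ R f, f != 0, v f = - m%:Z & v' f = - m'%:Z] &
     forall g, R g -> g != 0 -> v g = - m%:Z -> v' g <= - m'%:Z].
  move=> m; have [h|h] := pselect (two_gen a b m%:Z); first by exists 0%N.
  by have [m' hm'] := gap_partner hS' hval h; exists m'.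
have s_inj m n : ~ two_gen a b m%:Z -> ~ two_gen a b n%:Z -> s m = s n ->
    (m < n)%N -> False.
  move=> /hs[_ [f [Rf f0 vf v'f]] _] /hs[_ [g [Rg g0 vg v'g]] min] e mn.
  have [|z hz] := valuation_residue hv' g0 f0; first by rewrite v'f v'g e.
  have [|h1 vh] := valuation_dominant hv g0 (g := - (c z * f)).
    apply: (order_geN hv); apply: (order_geMc hv).
    by rewrite order_geE // vf vg; lia.
  have := min (g - c z * f) (pairB z Rg Rf) h1; rewrite vh => /(_ vg).
  by move: hz; rewrite order_geE // v'g => hz hz2; have := le_trans hz hz2; lia.
pose F' := absz (frobenius a' b').
have sF m : ~ two_gen a b m%:Z -> (s m < F'.+1)%N.
  move=> /hs[h _ _]; rewrite ltnNge; apply/negP => hF; apply: h.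
  by apply: two_gen_large => //; rewrite /F' in hF; lia.
pose si (i : 'I_(absz (frobenius a b)).+1) : 'I_F'.+1 := inord (s i).
rewrite /gap_number -(card_in_imset (f := si)).
  apply/subset_leq_card/fintype.subsetP => _ /imsetP[i hi ->].
  move: hi; rewrite !inE => /asboolPn hi; apply/asboolPn.
  by rewrite inordK ?sF //; case: (hs _ hi).
move=> i j; rewrite !inE => /asboolPn hi /asboolPn hj /(congr1 val).
rewrite /= !inordK ?sF // => e; apply: val_inj => /=.
by case: (ltngtP i j) => // h; [case: (s_inj i j)|case: (s_inj j i)].
Qed.

End OneSemigroup.

End TwoPlaces.

(** The smaller generator is bounded below by the smaller one at the other
    place, and symmetrically; the larger one is then determined by the number
    of gaps, which is (a - 1) * (b - 1) / 2. *)
Lemma two_places_lt (k K : fieldType) (c : {rmorphism k -> K}) (v v' : K -> int)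
    (R : K -> Prop) (a b a' b' : nat) :
  place_pair c v v' R ->
  (2 <= a)%N -> (a < b)%N -> coprime a b ->
  (2 <= a')%N -> (a' < b')%N -> coprime a' b' ->
  pole_semigroup v v' R a b -> pole_semigroup v' v R a' b' ->
  a = a' /\ b = b'.
Proof.
move=> hR a2 ab co a'2 ab' co' hS hS'.
have hR' := place_pair_sym hR.
have b2 : (2 <= b)%N by lia.
have b'2 : (2 <= b')%N by lia.
have a0 : (0 < a)%N by lia.
have b0 : (0 < b)%N by lia.
have a'0 : (0 < a')%N by lia.
have b'0 : (0 < b')%N by lia.
have aa' : (a <= a')%N.
  have [|f [Rf f0 vf v'f]] := (hS' a' a'0).1; first by exists 1%N, 0%N; lia.
  have := pole_order_lower_bound hR a2 b2 co hS ab (all_values hR' a'0 b'0 co' a0 hS' hS 1) Rf f0 vf.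
  by rewrite v'f; lia.
have a'a : (a' <= a)%N.
  have [|f [Rf f0 vf v'f]] := (hS a a0).1; first by exists 1%N, 0%N; lia.
  have := pole_order_lower_bound hR' a'2 b'2 co' hS' ab' (all_values hR a0 b0 co a'0 hS hS' 1) Rf f0 vf.
  by rewrite v'f; lia.
have e : a = a' by lia.
have g : gap_number a b = gap_number a' b'.
  apply/eqP; rewrite eqn_leq.
  by rewrite (gap_number_le hR a2 b2 co hS) // (gap_number_le hR' a'2 b'2 co' hS').
split=> //; subst a'.
have := gap_numberE a2 b2 co; rewrite g gap_numberE // => /eqP.
rewrite eqSS => /eqP.
have := frobenius_gt0 a2 b2 co; have := frobenius_gt0 a2 b'2 co'.
move=> F'0 F0 eF; have {F0 F'0 eF} : frobenius a b = frobenius a b' by lia.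
rewrite /frobenius => eF.
have : (a%:Z - 1) * (b%:Z - b'%:Z) == 0 by apply/eqP; lia.
by rewrite mulf_eq0 => /orP[]; lia.
Qed.

Lemma two_places (k K : fieldType) (c : {rmorphism k -> K}) (v v' : K -> int)
    (R : K -> Prop) (a b a' b' : nat) :
  place_pair c v v' R ->
  (2 <= a)%N -> (2 <= b)%N -> coprime a b ->
  (2 <= a')%N -> (2 <= b')%N -> coprime a' b' ->
  pole_semigroup v v' R a b -> pole_semigroup v' v R a' b' ->
  forall z, two_gen a b z <-> two_gen a' b' z.
Proof.
move=> hR.
wlog ab : a b / (a < b)%N.
  move=> H a2 b2 co; have := co.
  case: (ltngtP a b) => [ab _|ba|->]; first exact: H.
    rewrite coprime_sym => co2 a'2 b'2 co' hS hS' z.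
    have hS2 : pole_semigroup v v' R b a.
      by move=> m m0; rewrite -hS //; split=> /two_genC.
    have [h1 h2] := H b a ba b2 a2 co2 a'2 b'2 co' hS2 hS' z.
    by split=> [/two_genC|/h2/two_genC].
  by rewrite /coprime gcdnn => /eqP b1; move: b2; rewrite b1.
move=> a2 b2 co.
wlog ab' : a' b' / (a' < b')%N.
  move=> H a'2 b'2 co'; have := co'.
  case: (ltngtP a' b') => [ab' _|ba|->]; first exact: H.
    rewrite coprime_sym => co2 hS hS' z.
    have hS2 : pole_semigroup v' v R b' a'.
      by move=> m m0; rewrite -hS' //; split=> /two_genC.
    have [h1 h2] := H b' a' ba b'2 a'2 co2 hS hS2 z.
    by split=> [/h1/two_genC|/two_genC].
  by rewrite /coprime gcdnn => /eqP b1; move: b'2; rewrite b1.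
move=> a'2 b'2 co' hS hS' z.
by have [-> ->] := two_places_lt hR a2 ab co a'2 ab' co' hS hS'.
Qed.

(** * Noetherianity of polynomial rings *)

(** The subsequence consists of positions where s attains the minimum of all
    its later values. *)
Lemma nondecreasing_subsequence (s : nat -> nat) :
  exists phi : nat -> nat, (forall i j, (i < j)%N -> (phi i < phi j)%N) /\
    (forall i j, (i < j)%N -> (s (phi i) <= s (phi j))%N).
Proof.
have /choice[g hg] N : exists i, (N <= i)%N /\
    forall j, (i <= j)%N -> (s i <= s j)%N.
  pose Q m := `[< exists2 i, (N <= i)%N & s i = m >].
  have exQ : exists m, Q m by exists (s N); apply/asboolP; exists N.
  case: (ex_minnP exQ) => m /asboolP[i Ni <-] min; exists i; split=> // j ij.
  by apply: min; apply/asboolP; exists j => //; apply: leq_trans ij.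
pose phi n := iter n (fun m => g m.+1) (g 0%N).
have phiS n : (phi n < phi n.+1)%N by rewrite /phi iterS; case: (hg (phi n).+1).
have phi_lt i j : (i < j)%N -> (phi i < phi j)%N.
  by apply: (homo_ltn ltn_trans).
exists phi; split=> // i j ij.
have : forall l, (phi i <= l)%N -> (s (phi i) <= s l)%N.
  by rewrite /phi; case: i {ij} => [|i] /=; [case: (hg 0%N)|case: (hg (phi i).+1)].
by apply; apply: ltnW; apply: phi_lt.
Qed.

(** Extracting nondecreasing subsequences one coordinate at a time. *)
Lemma dickson n (m : nat -> 'X_{1..n}) :
  exists i j, (i < j)%N /\ (m i <= m j)%MM.
Proof.
suff main (l : seq 'I_n) : exists phi : nat -> nat,
    (forall i j, (i < j)%N -> (phi i < phi j)%N) /\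
    (forall x, x \in l -> forall i j, (i < j)%N -> (m (phi i) x <= m (phi j) x)%N).
  have [phi [inc h]] := main (enum 'I_n).
  exists (phi 0%N), (phi 1%N); split; first exact: inc.
  by apply/mnm_lepP => x; apply: h; rewrite ?mem_enum.
elim: l => [|x l [phi [inc h]]]; first by exists id.
have [psi [incp hp]] := nondecreasing_subsequence (fun i => m (phi i) x).
exists (phi \o psi); split=> [i j ij|y]; first by apply: inc; apply: incp.
rewrite inE => /orP[/eqP ->|yl] i j ij; first exact: hp.
by apply: h => //; apply: incp.
Qed.

Lemma mlead_min (k : fieldType) n (P : {mpoly k[n]} -> Prop) p : P p ->
  exists r, P r /\ forall q, P q -> (mlead r <= mlead q)%O.
Proof.
move: {2}(mlead p) (erefl (mlead p)) => m.
elim/(well_founded_ind (@ltom_wf n)): m p => m IH p pm Pp.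
have [[q [Pq qp]]|h] := pselect (exists q, P q /\ (mlead q < mlead p)%O).
  by apply: (IH (mlead q) _ q) => //; rewrite -pm.
exists p; split=> // q Pq; rewrite leNgt; apply/negP => qp; apply: h.
by exists q.
Qed.

Section HilbertBasis.

Variables (k : fieldType) (n : nat) (p : nat -> {mpoly k[n]}).

Let I N f := exists a : nat -> {mpoly k[n]}, f = \sum_(i < N) a i * p i.

(** Otherwise reduce each p N modulo its predecessors to a remainder r N with
    minimal leading monomial.  By Dickson's lemma the leading monomial of some
    r i divides that of a later r j, and subtracting a multiple of r i from
    r j contradicts minimality. *)
Lemma hilbert_basis : exists N, exists a : nat -> {mpoly k[n]},
  p N = \sum_(i < N) a i * p i.
Proof.
have ID N f g : I N f -> I N g -> I N (f + g).
  move=> [a ->] [b ->]; exists (fun i => a i + b i).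
  by rewrite -big_split; apply: eq_bigr => i _; rewrite mulrDl.
have IM N f g : I N f -> I N (g * f).
  move=> [a ->]; exists (fun i => g * a i).
  by rewrite mulr_sumr; apply: eq_bigr => i _; rewrite mulrA.
have IS N f : I N f -> I N.+1 f.
  move=> [a ->]; exists (fun i => if (i < N)%N then a i else 0).
  rewrite big_ord_recr /= ltnn mul0r addr0.
  by apply: eq_bigr => i _; rewrite ltn_ord.
have Ile N M f : (N <= M)%N -> I N f -> I M f.
  elim: M => [|M IH]; first by rewrite leqn0 => /eqP ->.
  by rewrite leq_eqVlt => /orP[/eqP <-|/IH h /h /IS].
have Ip N : I N.+1 (p N).
  exists (fun i => (i == N)%:R); rewrite big_ord_recr /= eqxx mul1r big1 ?add0r //.
  by move=> i _; rewrite (ltn_eqF (ltn_ord i)) mul0r.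
apply: contrapT => none.
have nI N : ~ I N (p N) by move=> h; apply: none; exists N.
have I0 N : I N 0.
  by exists (fun=> 0); rewrite big1 // => i _; rewrite mul0r.
have /choice[r hr] N : exists r, I N (p N - r) /\
    forall q, I N (p N - q) -> (mlead r <= mlead q)%O.
  by apply: (mlead_min (p := p N)); rewrite subrr.
have r0 N : r N != 0.
  by apply/eqP => h; case: (hr N); rewrite h subr0 => /nI.
have Ir N : I N.+1 (r N).
  rewrite -[r N]opprK -[- r N](addKr (p N)) opprD opprK; apply: ID => //.
  by rewrite -mulN1r; apply: IM; apply: IS; case: (hr N); rewrite addrC.
have [i [j [ij mij]]] := dickson (fun N => mlead (r N)).
pose s := ((r j)@_(mlead (r j)) / (r i)@_(mlead (r i))) *:
  ('X_[mlead (r j) - mlead (r i)] * r i).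
have lci : (r i)@_(mlead (r i)) != 0 by rewrite mleadc_eq0.
have lcj : (r j)@_(mlead (r j)) != 0 by rewrite mleadc_eq0.
have X0 : 'X_[mlead (r j) - mlead (r i)] != 0 :> {mpoly k[n]}.
  by rewrite -mleadc_eq0 mleadXm mcoeffX eqxx oner_eq0.
have leads : mlead s = mlead (r j).
  by rewrite mleadZ ?mulf_neq0 ?invr_eq0 // mleadM // mleadXm submK.
have lcs : s@_(mlead s) = (r j)@_(mlead (r j)).
  rewrite mleadcZE mleadM // mleadcM mleadXm mcoeffX eqxx mul1r.
  by rewrite mulfVK.
have Irs : I j (p j - (r j - s)).
  rewrite opprB addrCA addrC; apply: ID; first by case: (hr j).
  by rewrite /s -mul_mpolyC mulrA; apply: IM; apply: Ile (Ir i).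
have d0 : r j - s != 0.
  by apply/eqP => h; apply: (nI j); move: Irs; rewrite h subr0.
have := (hr j).2 _ Irs; apply/negP; rewrite -ltNge lt_neqAle.
apply/andP; split; last first.
  by apply: le_trans (mleadB_le _ _) _; rewrite leads joinxx.
apply: contraNneq d0 => h; rewrite -mleadc_eq0 h mcoeffB -{2}leads lcs.
by rewrite subrr.
Qed.

End HilbertBasis.

(** * From a Noetherian local ring to a discrete valuation *)

(** A local subring O of K with maximal ideal M, residue field k and fraction
    field K.  Noetherianity is the statement that in every sequence some term
    is a combination of its predecessors. *)
Record noetherian_local_ring (k K : fieldType) (c : {rmorphism k -> K})
    (O M : K -> Prop) : Prop := NoetherianLocalRing {
  local_const : forall x, O (c x);
  localD : forall f g, O f -> O g -> O (f + g);
  localM : forall f g, O f -> O g -> O (f * g);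
  maximal_local : forall f, M f -> O f;
  maximalM : forall f g, M f -> O g -> M (f * g);
  maximal1 : ~ M 1;
  local_unit : forall f, O f -> ~ M f -> O f^-1;
  local_residue : forall f, O f -> exists x, M (f - c x);
  local_frac : forall f, exists g h, [/\ O g, O h, h != 0 & f = g / h];
  local_noether : forall s : nat -> K, (forall i, O (s i)) ->
    exists N (a : nat -> K), (forall i, O (a i)) /\ s N = \sum_(i < N) a i * s i }.

Definition generates_maximal (K : fieldType) (O M : K -> Prop) (t : K) : Prop :=
  M t /\ forall f, M f -> exists2 g, O g & f = t * g.

Section Discrete.

Variables (k K : fieldType) (c : {rmorphism k -> K}) (O M : K -> Prop) (t : K).
Hypothesis hO : noetherian_local_ring c O M.
Hypothesis ht : generates_maximal O M t.
Hypothesis t0 : t != 0.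

Let Ot : O t := maximal_local hO (proj1 ht).

Let O1 : O 1.
Proof. by rewrite -(rmorph1 c); apply: (local_const hO). Qed.

Let OX n : O (t ^+ n).
Proof.
elim: n => [|n IH]; first by rewrite expr0.
by rewrite exprS; apply: (localM hO).
Qed.

Let unit0 u : ~ M u -> u != 0.
Proof.
move=> nu; apply/eqP => u0; apply: nu; rewrite u0 -(mulr0 t).
by apply: (maximalM hO) (proj1 ht) _; rewrite -(rmorph0 c); apply: (local_const hO).
Qed.

Let unitM u w : O u -> ~ M u -> O w -> ~ M w -> ~ M (u * w).
Proof.
move=> Ou nu Ow nw h; apply: nw.
have := maximalM hO h (local_unit hO Ou nu).
by rewrite mulrAC mulfV ?mul1r //; apply: unit0.
Qed.

Let unitV u : O u -> ~ M u -> ~ M u^-1.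
Proof.
move=> Ou nu h; apply: (maximal1 hO).
by rewrite -(mulVf (unit0 nu)); apply: (maximalM hO).
Qed.

(** Krull's intersection theorem for a principal maximal ideal.  If f were
    divisible by all powers of t, say f = t ^+ n * s n, the sequence s would
    generate ideals increasing for ever: from s N in the ideal of the earlier
    s i = t ^+ (N - i) * s N one gets that t divides 1. *)
Lemma local_factor f : O f -> f != 0 ->
  exists n u, [/\ O u, ~ M u & f = t ^+ n * u].
Proof.
move=> Of f0; apply: contrapT => none.
have /choice[s hs] n : exists g, O g /\ f = t ^+ n * g.
  elim: n => [|n [g [Og fE]]]; first by exists f; rewrite expr0 mul1r.
  have [/(proj2 ht)[h Oh gE]|ng] := pselect (M g); last first.
    by case: none; exists n, g.
  by exists h; rewrite exprSr -mulrA -gE.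
have [N [a [Oa sN]]] := local_noether hO (fun i => (hs i).1).
pose b := \sum_(i < N) a i * t ^+ (N - i.+1).
have Ob : O b.
  apply: (big_ind O); [by rewrite -(rmorph0 c); apply: (local_const hO)|exact: (localD hO)|].
  by move=> i _; apply: (localM hO).
have sN0 : s N != 0.
  by apply: contraNneq f0 => h; rewrite (hs N).2 h mulr0.
apply: (maximal1 hO); suff -> : 1 = t * b by apply: (maximalM hO) (proj1 ht) Ob.
apply: (mulIf sN0); rewrite mul1r {1}sN /b mulr_sumr mulr_suml.
apply: eq_bigr => i _; have iN := ltn_ord i.
have -> : s i = t * t ^+ (N - i.+1) * s N.
  apply: (mulfI (expf_neq0 i t0)); rewrite -(hs i).2 (hs N).2.
  by rewrite -exprS mulrA -exprD; congr (t ^+ _ * _); lia.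
ring.
Qed.

Lemma local_factor_int f : f != 0 -> exists z : int,
  exists u, [/\ O u, ~ M u & f = t ^ z * u].
Proof.
have [g [h [Og Oh h0 ->]]] := local_frac hO f => gh0.
have g0 : g != 0 by apply: contraNneq gh0 => ->; rewrite mul0r.
have [n [u [Ou nu ->]]] := local_factor Og g0.
have [m [w [Ow nw ->]]] := local_factor Oh h0.
exists (n%:Z - m%:Z), (u / w); split.
- by apply: (localM hO) => //; apply: (local_unit hO).
- by apply: unitM => //; [apply: (local_unit hO)|apply: unitV].
- by rewrite expfzDr // -exprnN -exprnP invfM mulrACA.
Qed.

Lemma discrete_valuation : exists v : K -> int,
  [/\ residual_valuation c v, forall f, O f <-> order_ge v 0 f,
      forall f, M f <-> order_ge v 1 f & v t = 1].
Proof.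
have /choice[v hv] f : exists z : int, f != 0 ->
    exists u, [/\ O u, ~ M u & f = t ^ z * u].
  have [->|/local_factor_int[z hz]] := eqVneq f 0; first by exists 0.
  by exists z.
have tz0 (z : int) : t ^ z != 0 by rewrite expfz_neq0.
have OE f : f != 0 -> O f <-> 0 <= v f.
  move=> f0; have [u [Ou nu fE]] := hv f f0; split=> [Of|].
    rewrite leNgt; apply/negP => vf; apply: nu.
    move: (v f) fE vf => z fE vf.
    have -> : u = t * (t ^+ (absz z).-1 * f).
      rewrite fE mulrA -exprS mulrA exprnP -expfzDr //.
      have -> : (absz z).-1.+1%:Z + z = 0 by lia.
      by rewrite expr0z mul1r.
    by apply: (maximalM hO) (proj1 ht) _; apply: (localM hO).
  case: (v f) fE => // n fE _; rewrite fE -exprnP; exact: (localM hO).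
have ME f : f != 0 -> M f <-> 1 <= v f.
  move=> f0; have [u [Ou nu fE]] := hv f f0; split=> [Mf|].
    have := (OE f f0).1 (maximal_local hO Mf).
    rewrite le_eqVlt => /orP[/eqP h|]; last by lia.
    by case: nu; move: Mf; rewrite fE -h expr0z mul1r.
  case: (v f) fE => [[|n]|//] // fE _; rewrite fE -exprnP exprS -mulrA.
  by apply: (maximalM hO) (proj1 ht) _; apply: (localM hO).
have vE f z u : O u -> ~ M u -> f = t ^ z * u -> v f = z.
  move=> Ou nu fE; have u0 := unit0 nu.
  have f0 : f != 0 by rewrite fE mulf_neq0.
  have [w [Ow nw fE']] := hv f f0.
  have key (m n : int) p q : O p -> ~ M p -> O q -> ~ M q ->
      t ^ m * p = t ^ n * q -> ~ (n < m).
    move=> Op np Oq nq e nm; apply: nq.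
    have -> : q = t * (t ^+ (absz (m - n)).-1 * p).
      apply: (mulfI (tz0 n)); rewrite -e !mulrA; congr (_ * p).
      rewrite -mulrA -exprS exprnP -expfzDr //; congr (t ^ _); lia.
    by apply: (maximalM hO) (proj1 ht) _; apply: (localM hO).
  have e : t ^ (v f) * w = t ^ z * u by rewrite -fE -fE'.
  apply/eqP; rewrite eq_le !leNgt; apply/andP; split; apply/negP.
    exact: key e.
  exact: key (esym e).
have vM f g : f != 0 -> g != 0 -> v (f * g) = v f + v g.
  move=> f0 g0; have [u [Ou nu fE]] := hv f f0; have [w [Ow nw gE]] := hv g g0.
  apply: (vE _ _ (u * w)); [exact: (localM hO)|exact: unitM|].
  by rewrite {1}fE {1}gE expfzDr // mulrACA.
have vt (z : int) : v (t ^ z) = z.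
  by apply: (vE _ _ 1) => //; [exact: (maximal1 hO)|rewrite mulr1].
have geE m f : order_ge v m f <-> O (t ^ (- m) * f).
  have [->|f0] := eqVneq f 0.
    rewrite mulr0 /order_ge eqxx; split=> // _.
    by rewrite -(rmorph0 c); apply: (local_const hO).
  rewrite OE ?mulf_neq0 // vM // vt /order_ge (negPf f0) /=; lia.
have O0 : O 0 by rewrite -(rmorph0 c); apply: (local_const hO).
have M0 : M 0 by rewrite -(mulr0 t); apply: (maximalM hO) (proj1 ht) _.
have ge1 f : M f <-> order_ge v 1 f.
  have [->|f0] := eqVneq f 0; first by rewrite /order_ge eqxx.
  by rewrite /order_ge (negPf f0); apply: ME.
exists v; split=> //; last by rewrite -[t]expr1z vt.
- split=> //.
  + by move=> m f g /geE hf /geE hg; apply/geE; rewrite mulrDr; apply: (localD hO).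
  + move=> x x0; apply: (vE _ _ (c x)); rewrite ?expr0z ?mul1r //.
      exact: (local_const hO).
    move=> h; apply: (maximal1 hO); rewrite -(rmorph1 c) -(mulfV x0) rmorphM.
    by apply: (maximalM hO) => //; apply: (local_const hO).
  + move=> f g f0 g0 fg.
    have vfg : v (f / g) = 0.
      by have := vM (f / g) g; rewrite divfK // mulf_neq0 ?invr_eq0 // fg => /(_ isT g0); lia.
    have [|x hx] := local_residue hO (f := f / g).
      by apply/OE; rewrite ?vfg // mulf_neq0 ?invr_eq0.
    exists x; have -> : f - c x * g = (f / g - c x) * g by rewrite mulrBl divfK.
    have [->|h0] := eqVneq (f / g - c x) 0; first by rewrite mul0r /order_ge eqxx.
    move/(ME _ h0): hx => hx.
    by rewrite /order_ge (negPf (mulf_neq0 h0 g0)) vM //= fg; lia.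
- by move=> f; rewrite geE oppr0 expr0z mul1r.
Qed.

End Discrete.

(** * Homogeneous polynomials at points of projective space *)

Section Points.

Variables (k : fieldType) (n : nat).
Implicit Types (p q : {mpoly k[n.+1]}) (P Q : projspace k n).

Lemma meval_scale d p a (e : 'rV[k]_n.+1) : p \is d.-homog ->
  p.@[(a *: e) ord0] = a ^+ d * p.@[e ord0].
Proof.
move=> /dhomogP hp; rewrite !mevalE mulr_sumr !big_seq.
apply: eq_bigr => m /hp md; rewrite mulrCA; congr (_ * _).
rewrite -[d in RHS]md /= mdegE -prodrXr -big_split /=.
by apply: eq_bigr => i _; rewrite mxE exprMn.
Qed.

Definition representative P : 'rV[k]_n.+1 := vpick (val P).

Lemma representative_in P : representative P \in val P.
Proof. exact: memv_pick. Qed.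

Lemma representative_neq0 P : representative P != 0.
Proof. by rewrite vpick0 -dimv_eq0 (eqP (valP P)). Qed.

Lemma representative_span P v : v \in val P ->
  exists a, v = a *: representative P.
Proof.
have -> : val P = <[representative P]>%VS.
  apply/esym/eqP; rewrite eqEdim (eqP (valP P)) dim_vline representative_neq0 andbT.
  by rewrite -memvE representative_in.
by move/vlineP.
Qed.

Definition value P p : k := p.@[representative P ord0].

Lemma vanishesE d p P : p \is d.-homog -> vanishes_at p P <-> value P p = 0.
Proof.
move=> hp; split=> [|h v]; first by apply; apply: representative_in.
by move/representative_span => [a ->]; rewrite (meval_scale _ _ hp) -/(value _ _) h mulr0.
Qed.

Lemma vanishes_value p P : vanishes_at p P -> value P p = 0.
Proof. by apply; apply: representative_in. Qed.

Lemma vanishesD p q P : vanishes_at p P -> vanishes_at q P -> vanishes_at (p + q) P.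
Proof. by move=> hp hq v vP; rewrite mevalD hp ?hq ?addr0. Qed.

Lemma vanishesM p q P : vanishes_at q P -> vanishes_at (p * q) P.
Proof. by move=> hq v vP; rewrite mevalM hq ?mulr0. Qed.

Variable C : set (projspace k n).

Lemma vanishing_ideal0 : vanishing_ideal C 0.
Proof. by move=> P _ v _; rewrite meval0. Qed.

Lemma vanishing_idealD p q :
  vanishing_ideal C p -> vanishing_ideal C q -> vanishing_ideal C (p + q).
Proof. by move=> hp hq P CP; apply: vanishesD; [apply: hp|apply: hq]. Qed.

Lemma vanishing_idealM p q : vanishing_ideal C q -> vanishing_ideal C (p * q).
Proof. by move=> hq P CP; apply: vanishesM; apply: hq. Qed.

(** Irreducibility, applied to the zero sets of p and q; homogeneity is what
    makes these zero sets closed. *)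
Lemma vanishing_ideal_prime d e p q : zariski_irreducible C ->
  p \is d.-homog -> q \is e.-homog ->
  vanishing_ideal C (p * q) -> vanishing_ideal C p \/ vanishing_ideal C q.
Proof.
move=> [_ irr] hp hq hpq.
pose Z (r : {mpoly k[n.+1]}) : set (projspace k n) :=
  [set P | forall s, [set r] s -> vanishes_at s P]%classic.
have Zc d' r : r \is d'.-homog -> zariski_closed (Z r).
  by move=> hr; exists [set r]%classic; split=> // s ->; exists d'.
have [|h|h] := irr _ _ (Zc d p hp) (Zc e q hq).
- move=> P CP; have := vanishes_value (hpq P CP).
  rewrite /value mevalM => /eqP; rewrite mulf_eq0 => /orP[]/eqP h.
    by left => s ->; apply/(vanishesE _ hp).
  by right => s ->; apply/(vanishesE _ hq).
- by left => P /h; apply.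
- by right => P /h; apply.
Qed.

End Points.

(** * The function field *)

Section FunctionField.

Variables (k : fieldType) (n : nat) (C : set (projspace k n)).
Hypothesis hC : zariski_irreducible C.
Implicit Types (p q : {mpoly k[n.+1]}) (phi psi : frac k n).

Lemma vanishing_ideal1 : ~ vanishing_ideal C 1.
Proof.
case: hC => -[P CP] _ /(_ P CP)/vanishes_value/eqP.
by rewrite /value meval1 oner_eq0.
Qed.

Lemma rational_mul phi psi :
  rational_on C phi -> rational_on C psi -> rational_on C (frac_mul phi psi).
Proof.
move=> [[d [h1 h2]] h] [[e [g1 g2]] g]; split.
  by exists (d + e)%N; split; apply: dhomogM.
by case/(vanishing_ideal_prime hC h2 g2).
Qed.

Definition frac_add phi psi : frac k n :=
  (phi.1 * psi.2 + psi.1 * phi.2, phi.2 * psi.2).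

Lemma rational_add phi psi :
  rational_on C phi -> rational_on C psi -> rational_on C (frac_add phi psi).
Proof.
move=> hphi hpsi; split; last by case: (rational_mul hphi hpsi).
move: hphi hpsi => [[d [h1 h2]] h] [[e [g1 g2]] g].
exists (d + e)%N; split; last exact: dhomogM.
by apply: rpredD; [|rewrite addnC]; apply: dhomogM.
Qed.

Definition frac_opp phi : frac k n := (- phi.1, phi.2).

Lemma rational_opp phi : rational_on C phi -> rational_on C (frac_opp phi).
Proof. by move=> [[d [h1 h2]] h]; split=> //; exists d; rewrite rpredN. Qed.

Definition frac_const (a : k) : frac k n := (a%:MP, 1).

Lemma rational_const a : rational_on C (frac_const a).
Proof.
split; last exact: vanishing_ideal1.
exists 0%N; split; last exact: dhomog1.
by rewrite /= -[a%:MP]mulr1 mul_mpolyC; apply: rpredZ; apply: dhomog1.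
Qed.

Definition frac_inv phi : frac k n :=
  if `[< vanishing_ideal C phi.1 >] then frac_const 0 else (phi.2, phi.1).

Lemma rational_inv phi : rational_on C phi -> rational_on C (frac_inv phi).
Proof.
move=> [[d [h1 h2]] h]; rewrite /frac_inv; case: asboolP => [_|h'].
  exact: rational_const.
by split=> //; exists d.
Qed.

Lemma frac_eq_poly phi psi : phi.1 * psi.2 = psi.1 * phi.2 -> frac_eq C phi psi.
Proof. by rewrite /frac_eq => ->; rewrite subrr; apply: vanishing_ideal0. Qed.

Lemma frac_eq_sym phi psi : frac_eq C phi psi -> frac_eq C psi phi.
Proof. by move=> h; rewrite /frac_eq -opprB -mulN1r; apply: vanishing_idealM. Qed.

(** Cancelling psi.2 is possible because the vanishing ideal is prime. *)
Lemma frac_eq_trans phi psi chi :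
    rational_on C phi -> rational_on C psi -> rational_on C chi ->
  frac_eq C phi psi -> frac_eq C psi chi -> frac_eq C phi chi.
Proof.
move=> [[d [h1 h2]] h] [[e [g1 g2]] g] [[f [i1 i2]] i] e1 e2.
have hd : phi.1 * chi.2 - chi.1 * phi.2 \is (d + f).-homog.
  by apply: rpredB; [|rewrite addnC]; apply: dhomogM.
case: (@vanishing_ideal_prime _ _ C _ _ psi.2 _ hC g2 hd) => //.
have -> : psi.2 * (phi.1 * chi.2 - chi.1 * phi.2) =
    chi.2 * (phi.1 * psi.2 - psi.1 * phi.2) +
    phi.2 * (psi.1 * chi.2 - chi.1 * psi.2) by ring.
by apply: vanishing_idealD; apply: vanishing_idealM.
Qed.

Definition ratfrac := {phi : frac k n | `[< rational_on C phi >]}.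

HB.instance Definition _ := Choice.on ratfrac.

Definition ratfrac_eq (x y : ratfrac) : bool := `[< frac_eq C (val x) (val y) >].

Lemma ratfracP (x : ratfrac) : rational_on C (val x).
Proof. exact/asboolP/(valP x). Qed.

Lemma ratfrac_eq_refl : reflexive ratfrac_eq.
Proof. by move=> x; apply/asboolP; apply: frac_eq_poly. Qed.

Lemma ratfrac_eq_sym : ssrbool.symmetric ratfrac_eq.
Proof. by move=> x y; apply/asboolP/asboolP; apply: frac_eq_sym. Qed.

Lemma ratfrac_eq_trans : transitive ratfrac_eq.
Proof.
move=> y x z /asboolP xy /asboolP yz; apply/asboolP.
exact: frac_eq_trans (ratfracP x) (ratfracP y) (ratfracP z) xy yz.
Qed.

Canonical ratfrac_equiv :=
  EquivRel ratfrac_eq ratfrac_eq_refl ratfrac_eq_sym ratfrac_eq_trans.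

Definition funfield := {eq_quot ratfrac_eq}%qT.

HB.instance Definition _ : EqQuotient _ ratfrac_eq funfield := EqQuotient.on funfield.
HB.instance Definition _ := Choice.on funfield.

Definition ratfrac1 : ratfrac := Sub (frac_const 1) (asboolT (rational_const 1)).

Definition cls phi : funfield := \pi_funfield (insubd ratfrac1 phi).

Lemma cls_eq phi psi : rational_on C phi -> rational_on C psi ->
  cls phi = cls psi <-> frac_eq C phi psi.
Proof.
move=> hphi hpsi; rewrite /cls; split=> [/eqmodP|h].
  by move/asboolP; rewrite !val_insubd !asboolT.
by apply/eqmodP; apply/asboolP; rewrite !val_insubd !asboolT.
Qed.

Definition rep (x : funfield) : frac k n := val (repr x).

Lemma rep_rational x : rational_on C (rep x).
Proof. exact: ratfracP. Qed.

Lemma repK x : cls (rep x) = x.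
Proof.
rewrite /cls -[RHS]reprK; congr (\pi _); apply: val_inj.
by rewrite val_insubd (valP (repr x)).
Qed.

Lemma cls_surj x : exists2 phi, rational_on C phi & x = cls phi.
Proof. by exists (rep x); [apply: rep_rational|rewrite repK]. Qed.

Lemma rep_cls phi : rational_on C phi -> frac_eq C (rep (cls phi)) phi.
Proof. by move=> h; apply/cls_eq => //; [apply: rep_rational|rewrite repK]. Qed.

Let add x y := cls (frac_add (rep x) (rep y)).
Let opp x := cls (frac_opp (rep x)).
Let mul x y := cls (frac_mul (rep x) (rep y)).
Let inv x := cls (frac_inv (rep x)).

Lemma cls_add phi psi : rational_on C phi -> rational_on C psi ->
  add (cls phi) (cls psi) = cls (frac_add phi psi).
Proof.
move=> h1 h2; have [r1 r2] := (rep_rational (cls phi), rep_rational (cls psi)).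
apply/cls_eq; try exact: rational_add.
have := (rep_cls h1, rep_cls h2); rewrite /frac_eq /=.
move: (rep _) (rep _) {r1 r2} => [c d] [a b] /= [e1 e2].
have -> : (a * d + c * b) * (phi.2 * psi.2) - (phi.1 * psi.2 + psi.1 * phi.2) * (b * d)
  = (d * psi.2) * (a * phi.2 - phi.1 * b) + (b * phi.2) * (c * psi.2 - psi.1 * d)
  by ring.
by apply: vanishing_idealD; apply: vanishing_idealM.
Qed.

Lemma cls_mul phi psi : rational_on C phi -> rational_on C psi ->
  mul (cls phi) (cls psi) = cls (frac_mul phi psi).
Proof.
move=> h1 h2; have [r1 r2] := (rep_rational (cls phi), rep_rational (cls psi)).
apply/cls_eq; try exact: rational_mul.
have := (rep_cls h1, rep_cls h2); rewrite /frac_eq /=.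
move: (rep _) (rep _) {r1 r2} => [c d] [a b] /= [e1 e2].
have -> : a * c * (phi.2 * psi.2) - phi.1 * psi.1 * (b * d)
  = (c * psi.2) * (a * phi.2 - phi.1 * b) + (b * phi.1) * (c * psi.2 - psi.1 * d)
  by ring.
by apply: vanishing_idealD; apply: vanishing_idealM.
Qed.

Lemma cls_opp phi : rational_on C phi -> opp (cls phi) = cls (frac_opp phi).
Proof.
move=> h1; have r1 := rep_rational (cls phi).
apply/cls_eq; try exact: rational_opp.
have := rep_cls h1; rewrite /frac_eq /=.
move: (rep _) {r1} => [a b] /= e1.
have -> : - a * phi.2 - - phi.1 * b = -1 * (a * phi.2 - phi.1 * b) by ring.
exact: vanishing_idealM.
Qed.

Lemma cls_eq0 phi : rational_on C phi ->
  cls phi = cls (frac_const 0) <-> vanishing_ideal C phi.1.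
Proof.
move=> h; rewrite cls_eq //; last exact: rational_const.
by rewrite /frac_eq /= mulr1 mpolyC0 mul0r subr0.
Qed.

Lemma cls_inv phi : rational_on C phi -> inv (cls phi) = cls (frac_inv phi).
Proof.
move=> h1; have r1 := rep_rational (cls phi).
apply/cls_eq; try exact: rational_inv.
have e : `[< vanishing_ideal C (rep (cls phi)).1 >] = `[< vanishing_ideal C phi.1 >].
  by apply/asboolP/asboolP; rewrite -!cls_eq0 // repK.
rewrite /frac_inv e; case: asboolP => _; first exact: frac_eq_poly.
have := rep_cls h1; rewrite /frac_eq /= => /(vanishing_idealM (-1)).
by rewrite mulN1r opprB mulrC [phi.2 * _]mulrC.
Qed.

Fact funfield_addA : associative add.
Proof.
move=> x y z; have [a ha ->] := cls_surj x; have [b hb ->] := cls_surj y.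
have [c hc ->] := cls_surj z.
have hab := rational_add ha hb; have hbc := rational_add hb hc.
rewrite !cls_add //; apply/cls_eq; try by apply: rational_add.
apply: frac_eq_poly => /=; ring.
Qed.

Fact funfield_addC : commutative add.
Proof.
move=> x y; have [a ha ->] := cls_surj x; have [b hb ->] := cls_surj y.
rewrite !cls_add //; apply/cls_eq; try by apply: rational_add.
apply: frac_eq_poly => /=; ring.
Qed.

Fact funfield_add0 : left_id (cls (frac_const 0)) add.
Proof.
move=> x; have [a ha ->] := cls_surj x; have h0 := rational_const 0.
rewrite cls_add //; apply/cls_eq => //; first exact: rational_add.
by apply: frac_eq_poly => /=; rewrite mpolyC0; ring.
Qed.

Fact funfield_addN : left_inverse (cls (frac_const 0)) opp add.
Proof.
move=> x; have [a ha ->] := cls_surj x; have h0 := rational_const 0.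
have hN := rational_opp ha.
rewrite cls_opp // cls_add //; apply/cls_eq => //; first exact: rational_add.
by apply: frac_eq_poly => /=; rewrite mpolyC0; ring.
Qed.

HB.instance Definition _ := GRing.isZmodule.Build funfield
  funfield_addA funfield_addC funfield_add0 funfield_addN.

Fact funfield_mulA : associative mul.
Proof.
move=> x y z; have [a ha ->] := cls_surj x; have [b hb ->] := cls_surj y.
have [c hc ->] := cls_surj z.
have hab := rational_mul ha hb; have hbc := rational_mul hb hc.
rewrite !cls_mul //; apply/cls_eq; try by apply: rational_mul.
apply: frac_eq_poly => /=; ring.
Qed.

Fact funfield_mulC : commutative mul.
Proof.
move=> x y; have [a ha ->] := cls_surj x; have [b hb ->] := cls_surj y.
rewrite !cls_mul //; apply/cls_eq; try by apply: rational_mul.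
apply: frac_eq_poly => /=; ring.
Qed.

Fact funfield_mul1 : left_id (cls (frac_const 1)) mul.
Proof.
move=> x; have [a ha ->] := cls_surj x; have h0 := rational_const 1.
rewrite cls_mul //; apply/cls_eq => //; first exact: rational_mul.
by apply: frac_eq_poly => /=; rewrite mpolyC1; ring.
Qed.

Fact funfield_mulD : left_distributive mul add.
Proof.
move=> x y z; have [a ha ->] := cls_surj x; have [b hb ->] := cls_surj y.
have [c hc ->] := cls_surj z.
have hab := rational_add ha hb; have hac := rational_mul ha hc.
have hbc := rational_mul hb hc.
rewrite cls_add // !cls_mul // cls_add //; apply/cls_eq.
- exact: rational_mul.
- exact: rational_add.
by apply: frac_eq_poly => /=; ring.
Qed.

Fact funfield_1neq0 : cls (frac_const 1) != cls (frac_const 0).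
Proof.
apply/eqP; rewrite cls_eq0 /= ?mpolyC1; last exact: rational_const.
exact: vanishing_ideal1.
Qed.

HB.instance Definition _ := GRing.Zmodule_isComNzRing.Build funfield
  funfield_mulA funfield_mulC funfield_mul1 funfield_mulD funfield_1neq0.

Fact funfield_mulV x : x != cls (frac_const 0) -> mul (inv x) x = cls (frac_const 1).
Proof.
have [a ha ->] := cls_surj x => /eqP; rewrite cls_eq0 // => na.
have hi := rational_inv ha; have h1 := rational_const 1.
rewrite cls_inv // cls_mul //; apply/cls_eq => //; first exact: rational_mul.
rewrite /frac_inv asboolF //; apply: frac_eq_poly => /=.
by rewrite mpolyC1; ring.
Qed.

Fact funfield_inv0 : inv (cls (frac_const 0)) = cls (frac_const 0).
Proof.
rewrite cls_inv; last exact: rational_const.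
by rewrite /frac_inv asboolT // /= mpolyC0; apply: vanishing_ideal0.
Qed.

HB.instance Definition _ :=
  GRing.ComNzRing_isField.Build funfield funfield_mulV funfield_inv0.

End FunctionField.

(** The properties of the quotient on which everything below depends.  Working
    with an arbitrary field that has them keeps the quotient construction out
    of later unification problems. *)
Record is_function_field (k : fieldType) (n : nat) (C : set (projspace k n))
    (K : fieldType) (cl : frac k n -> K) : Prop := IsFunctionField {
  class_surj : forall x, exists2 phi, rational_on C phi & x = cl phi;
  class_eq : forall phi psi, rational_on C phi -> rational_on C psi ->
    cl phi = cl psi <-> frac_eq C phi psi;
  classD : forall phi psi, rational_on C phi -> rational_on C psi ->
    cl phi + cl psi = cl (frac_add phi psi);
  classM : forall phi psi, rational_on C phi -> rational_on C psi ->
    cl phi * cl psi = cl (frac_mul phi psi);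
  class1 : cl (frac_const n 1) = 1 }.

Lemma function_field_exists (k : fieldType) (n : nat) (C : set (projspace k n)) :
  zariski_irreducible C ->
  exists (K : fieldType) (cl : frac k n -> K), is_function_field C cl.
Proof.
move=> hC; exists (funfield hC), (cls hC); split.
- exact: cls_surj.
- exact: cls_eq.
- exact: cls_add.
- exact: cls_mul.
- by [].
Qed.

(** * Local rings of the curve *)

Section FunctionFieldTheory.

Variables (k : fieldType) (n : nat) (C : set (projspace k n)).
Hypothesis hC : zariski_irreducible C.
Implicit Types (p q : {mpoly k[n.+1]}) (phi psi : frac k n) (P Q : projspace k n).

Variables (K : fieldType) (cl : frac k n -> K).
Hypothesis hK : is_function_field C cl.

Lemma class0 : cl (frac_const n 0) = 0.
Proof.
have [h0 h1] := (rational_const hC 0, rational_const hC 1).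
apply: (addIr (cl (frac_const n 1))); rewrite add0r (classD hK) //.
apply/(class_eq hK) => //; first exact: rational_add.
by apply: frac_eq_poly; rewrite /= mpolyC0; ring.
Qed.

Lemma class_eq0 phi : rational_on C phi -> cl phi = 0 <-> vanishing_ideal C phi.1.
Proof.
move=> h; rewrite -class0 (class_eq hK) //; last exact: rational_const.
by rewrite /frac_eq /= mulr1 mpolyC0 mul0r subr0.
Qed.

Lemma class_ext phi psi : rational_on C phi -> rational_on C psi ->
  phi.1 * psi.2 = psi.1 * phi.2 -> cl phi = cl psi.
Proof. by move=> h1 h2 e; apply/(class_eq hK) => //; apply: frac_eq_poly. Qed.

Definition funconst (a : k) : K := cl (frac_const n a).

Fact funconst_zmod : zmod_morphism funconst.
Proof.
move=> a b; have [ha hb] := (rational_const hC a, rational_const hC b).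
have hab := rational_const hC (a - b).
apply: (addIr (funconst b)); rewrite subrK (classD hK) //.
apply: class_ext => //; first exact: rational_add.
by rewrite /= !mulr1 -mpolyCD subrK.
Qed.

Fact funconst_monoid : monoid_morphism funconst.
Proof.
split=> [|a b]; first exact: (class1 hK).
have [ha hb] := (rational_const hC a, rational_const hC b).
have hab := rational_const hC (a * b).
rewrite [RHS](classM hK) //; apply: class_ext => //; first exact: rational_mul.
by rewrite /= !mulr1 mpolyCM.
Qed.

HB.instance Definition _ := GRing.isZmodMorphism.Build k K funconst funconst_zmod.
HB.instance Definition _ := GRing.isMonoidMorphism.Build k K funconst funconst_monoid.

Lemma rational_exp phi m : rational_on C phi -> rational_on C (frac_exp phi m).
Proof.
move=> h; elim: m => [|m IH].
  have := rational_const hC 1; rewrite /frac_exp /frac_const !expr0 mpolyC1.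
  by [].
have -> : frac_exp phi m.+1 = frac_mul phi (frac_exp phi m).
  by rewrite /frac_exp /frac_mul !exprS.
exact: rational_mul.
Qed.

Lemma classX phi m : rational_on C phi -> cl (frac_exp phi m) = cl phi ^+ m.
Proof.
move=> h; elim: m => [|m IH].
  by rewrite expr0 -(class1 hK) /frac_exp /frac_const !expr0 mpolyC1.
rewrite exprS -IH (classM hK) //; last exact: rational_exp.
by rewrite /frac_exp /frac_mul !exprS.
Qed.

Definition local_ring Q (x : K) : Prop := exists phi,
  [/\ rational_on C phi, ~ vanishes_at phi.2 Q & x = cl phi].

Definition local_max Q (x : K) : Prop := exists phi,
  [/\ rational_on C phi, ~ vanishes_at phi.2 Q, vanishes_at phi.1 Q & x = cl phi].

Lemma regular_atE Q phi : rational_on C phi ->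
  regular_at C Q phi <-> local_ring Q (cl phi).
Proof.
move=> h; split=> [[_ [psi [h1 /(class_eq hK h h1) -> h3]]]|[psi [h1 h2 /(class_eq hK) e]]].
  by exists psi.
by split=> //; exists psi; split=> //; apply: e.
Qed.

Lemma zero_atE Q phi : rational_on C phi ->
  zero_at C Q phi <-> local_max Q (cl phi).
Proof.
move=> h; split=> [[_ [psi [h1 /(class_eq hK h h1) -> h3 h4]]]|[psi [h1 h2 h3 /(class_eq hK) e]]].
  by exists psi.
by split=> //; exists psi; split=> //; apply: e.
Qed.

Section AtPoint.

Variable P : projspace k n.
Hypothesis CP : C P.

Lemma vanishes_mul d e p q : p \is d.-homog -> q \is e.-homog ->
  vanishes_at (p * q) P -> vanishes_at p P \/ vanishes_at q P.
Proof.
move=> hp hq /vanishes_value; rewrite /value mevalM => /eqP.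
by rewrite mulf_eq0 => /orP[]/eqP h; [left|right]; apply/vanishesE; eauto.
Qed.

Lemma not_vanishes_mul phi psi : rational_on C phi -> rational_on C psi ->
  ~ vanishes_at phi.2 P -> ~ vanishes_at psi.2 P ->
  ~ vanishes_at (phi.2 * psi.2) P.
Proof.
move=> [[d [_ h]] _] [[e [_ g]] _] nh ng.
by case/(vanishes_mul h g).
Qed.

Lemma local_ringC a : local_ring P (funconst a).
Proof.
exists (frac_const n a); split=> //; first exact: rational_const.
by move/vanishes_value/eqP; rewrite /value meval1 oner_eq0.
Qed.

Lemma local_ringD x y : local_ring P x -> local_ring P y -> local_ring P (x + y).
Proof.
move=> [phi [h1 h2 ->]] [psi [g1 g2 ->]]; exists (frac_add phi psi); split.
- exact: rational_add.
- exact: not_vanishes_mul.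
- by rewrite (classD hK).
Qed.

Lemma local_ringM x y : local_ring P x -> local_ring P y -> local_ring P (x * y).
Proof.
move=> [phi [h1 h2 ->]] [psi [g1 g2 ->]]; exists (frac_mul phi psi); split.
- exact: rational_mul.
- exact: not_vanishes_mul.
- by rewrite (classM hK).
Qed.

Lemma local_maxM x y : local_max P x -> local_ring P y -> local_max P (x * y).
Proof.
move=> [phi [h1 h2 h3 ->]] [psi [g1 g2 ->]]; exists (frac_mul phi psi); split.
- exact: rational_mul.
- exact: not_vanishes_mul.
- by rewrite /= mulrC; apply: vanishesM.
- by rewrite (classM hK).
Qed.

Lemma local_max1 : ~ local_max P 1.
Proof.
move=> [phi [h1 h2 h3]]; rewrite -(class1 hK) => /(class_eq hK (rational_const hC 1) h1).
rewrite /frac_eq /= mpolyC1 mul1r mulr1 => /(_ P CP) h.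
by apply: h2; rewrite -(subrK phi.1 phi.2); apply: vanishesD.
Qed.

Lemma local_ringV x : local_ring P x -> ~ local_max P x -> local_ring P x^-1.
Proof.
move=> [phi [h1 h2 xE]] nM; have nv : ~ vanishes_at phi.1 P.
  by move=> h; apply: nM; exists phi.
have nI : ~ vanishing_ideal C phi.1 by move/(_ P CP).
have hr : rational_on C (phi.2, phi.1).
  by case: h1 => [[d [? ?]] ?]; split=> //; exists d.
exists (phi.2, phi.1); split=> //.
apply: (mulIf (x := x)); first by apply/eqP; rewrite xE class_eq0.
rewrite mulVf; last by apply/eqP; rewrite xE class_eq0.
rewrite xE (classM hK) // -(class1 hK); apply: class_ext; [exact: rational_const|exact: rational_mul|].
by rewrite /= mpolyC1; ring.
Qed.

Lemma local_ring_residue x : local_ring P x -> exists a, local_max P (x - funconst a).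
Proof.
move=> [phi [h1 h2 ->]]; have [[d [h3 h4]] h5] := h1.
have q0 : value P phi.2 != 0.
  by apply/eqP => h; apply: h2; apply/(vanishesE _ h4).
pose a := value P phi.1 / value P phi.2.
have hr : rational_on C (phi.1 - a *: phi.2, phi.2).
  by split=> //; exists d; split=> //; apply: rpredB => //; apply: rpredZ.
exists a, (phi.1 - a *: phi.2, phi.2); split=> //=.
  apply/(@vanishesE _ _ d); first by case: hr => [[e [? ?]] _]; apply: rpredB => //; apply: rpredZ.
  by rewrite /value mevalB mevalZ -/(value _ _) -/(value _ _) divfK ?subrr.
have hc := rational_const hC a.
apply: (addIr (funconst a)); rewrite subrK (classD hK) //.
apply: class_ext => //; first exact: rational_add.
by rewrite /= -mul_mpolyC; ring.
Qed.

(** Homogeneous coordinates of a point are not all zero. *)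
Lemma exists_coordinate : exists i, ~ vanishes_at 'X_i P.
Proof.
apply: contrapT => h; have := representative_neq0 P; apply/negP/negPn/eqP.
apply/rowP => i; rewrite mxE; have /vanishes_value : vanishes_at 'X_i P.
  by apply: contrapT => hi; apply: h; exists i.
by rewrite /value mevalXU.
Qed.

Section Chart.

Variable i0 : 'I_n.+1.
Hypothesis hi0 : ~ vanishes_at 'X_i0 P.

Lemma homogX i : ('X_i : {mpoly k[n.+1]}) \is 1.-homog.
Proof. by rewrite dhomogX /= mdeg1. Qed.

Lemma homogXn i d : ('X_i ^+ d : {mpoly k[n.+1]}) \is d.-homog.
Proof. by rewrite -{2}[d]mul1n; apply: dhomogMn; apply: homogX. Qed.

Lemma chart_denominator d : ~ vanishes_at ('X_i0 ^+ d) P.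
Proof.
move/vanishes_value; rewrite /value rmorphXn => /eqP; rewrite expf_eq0 => /andP[_ /eqP].
by move=> h; apply: hi0; apply/(vanishesE _ (homogX i0)).
Qed.

Lemma rational_chart d p : p \is d.-homog -> rational_on C (p, 'X_i0 ^+ d).
Proof.
move=> hp; split; first by exists d; split=> //; apply: homogXn.
by move/(_ P CP)/chart_denominator.
Qed.

Definition coordinate i : K := cl ('X_i, 'X_i0).

(** Evaluation at the affine coordinates 'X_i / 'X_i0.  It is a ring morphism
    defined on all polynomials, so that relations between numerators can be
    moved into the function field whatever their degrees. *)
Definition dehomogenize : {mpoly k[n.+1]} -> K := mmap funconst coordinate.

Lemma coordinate_monomial m : mmap1 coordinate m = cl ('X_[m], 'X_i0 ^+ mdeg m).
Proof.
have rc i : rational_on C ('X_i, 'X_i0).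
  by have := rational_chart (homogX i); rewrite expr1.
rewrite /mmap1 mpolyXE_id mdegE.
suff main (l : seq 'I_n.+1) :
    rational_on C (\prod_(i <- l) 'X_i ^+ m i, 'X_i0 ^+ \sum_(i <- l) m i) /\
    \prod_(i <- l) coordinate i ^+ m i =
      cl (\prod_(i <- l) 'X_i ^+ m i, 'X_i0 ^+ \sum_(i <- l) m i).
  by case: (main (index_enum 'I_n.+1)).
elim: l => [|i l [IH1 IH2]].
  rewrite !big_nil expr0 -(class1 hK) /frac_const mpolyC1; split=> //.
  by have := rational_const hC 1; rewrite /frac_const mpolyC1.
rewrite !big_cons IH2 -classX // (classM hK) //; last exact: rational_exp.
rewrite /frac_mul /frac_exp /= exprD; split=> //.
by have := rational_mul hC (rational_exp (m i) (rc i)) IH1.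
Qed.

Lemma dehomogenizeE d p : p \is d.-homog -> dehomogenize p = cl (p, 'X_i0 ^+ d).
Proof.
move=> /dhomogP hp; rewrite /dehomogenize /mmap {3}[p]mpolyE.
elim: (msupp p) hp => [|m l IH] hp.
  rewrite !big_nil; apply/esym/class_eq0; last exact: vanishing_ideal0.
  by apply: rational_chart; apply: dhomog0.
have md : mdeg m = d by apply: hp; rewrite inE eqxx.
have hl : {in l, forall m, mdeg m = d} by move=> m' h; apply: hp; rewrite inE h orbT.
have h1 : p@_m *: 'X_[m] \is d.-homog by apply: rpredZ; rewrite dhomogX /= md.
have h2 : \sum_(m0 <- l) p@_m0 *: 'X_[m0] \is d.-homog.
  by rewrite big_seq; apply: rpred_sum => m' /hl e; apply: rpredZ; rewrite dhomogX /= e.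
rewrite !big_cons (IH hl) coordinate_monomial md.
have hm : ('X_[m] : {mpoly k[n.+1]}) \is d.-homog by rewrite dhomogX /= md.
have r1 := rational_chart h1; have r2 := rational_chart h2.
have r3 := rational_chart hm; have r4 := rational_chart (rpredD h1 h2).
have rc := rational_const hC p@_m; have rm := rational_mul hC rc r3.
rewrite {1}/funconst (classM hK) // (classD hK) //; apply: class_ext => //; first exact: rational_add.
by rewrite /= -mul_mpolyC; ring.
Qed.

Lemma dehomogenize_local p : local_ring P (dehomogenize p).
Proof.
have l1 : local_ring P 1 by rewrite -(class1 hK); apply: local_ringC.
apply: (big_ind (local_ring P)); [by rewrite -class0; apply: local_ringC|exact: local_ringD|].
move=> m _; apply: local_ringM; first exact: local_ringC.
rewrite coordinate_monomial; exists ('X_[m], 'X_i0 ^+ mdeg m); split=> //.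
  by apply: rational_chart; rewrite dhomogX.
exact: chart_denominator.
Qed.

Lemma class_dehomogenize phi : rational_on C phi ->
  dehomogenize phi.2 != 0 /\ cl phi = dehomogenize phi.1 / dehomogenize phi.2.
Proof.
move=> h; have [[d [h1 h2]] h3] := h; rewrite !(dehomogenizeE h1, dehomogenizeE h2).
have q0 : cl (phi.2, 'X_i0 ^+ d) != 0.
  by apply/eqP; rewrite class_eq0 //; apply: rational_chart.
split=> //; apply: (mulIf q0); rewrite divfK // (classM hK) //; last exact: rational_chart.
have r2 := rational_chart h2; have r1 := rational_chart h1.
by apply: class_ext => //; [exact: rational_mul|rewrite /=; ring].
Qed.

Lemma dehomogenize_inv phi : rational_on C phi -> ~ vanishes_at phi.2 P ->
  local_ring P (dehomogenize phi.2)^-1.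
Proof.
move=> [[d [h1 h2]] h3] h; apply: local_ringV; first exact: dehomogenize_local.
rewrite (dehomogenizeE h2) => -[psi [g1 g2 g3]].
have r2 := rational_chart h2.
move/(class_eq hK r2 g1); rewrite /frac_eq /= => /(_ P CP) e.
have [[e' [g4 g5]] g6] := g1.
have : vanishes_at (phi.2 * psi.2) P.
  rewrite -(subrK (psi.1 * 'X_i0 ^+ d) (phi.2 * psi.2)); apply: vanishesD => //.
  by rewrite mulrC; apply: vanishesM.
by case/(vanishes_mul h2 g5).
Qed.

(** The numerators of the s i satisfy a relation by the Hilbert basis theorem;
    the denominators become units after dehomogenization. *)
Lemma local_ring_noether (s : nat -> K) : (forall i, local_ring P (s i)) ->
  exists N (a : nat -> K), (forall i, local_ring P (a i)) /\
    s N = \sum_(i < N) a i * s i.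
Proof.
move=> /choice[phi hphi].
have [N [b hb]] := hilbert_basis (fun i => (phi i).1).
pose a i := dehomogenize (b i) * dehomogenize (phi i).2 * (dehomogenize (phi N).2)^-1.
exists N, a; split=> [i|].
  have [hN1 hN2 _] := hphi N; apply: local_ringM.
    by apply: local_ringM; apply: dehomogenize_local.
  exact: dehomogenize_inv.
have sE i : dehomogenize (phi i).2 != 0 /\
    s i = dehomogenize (phi i).1 / dehomogenize (phi i).2.
  by have [h1 _ ->] := hphi i; apply: class_dehomogenize.
rewrite (sE N).2 hb /dehomogenize rmorph_sum /= mulr_suml; apply: eq_bigr => i _.
rewrite (sE i).2 rmorphM /a /dehomogenize /=.
have [h0 _] := sE i; rewrite /dehomogenize in h0.
have cancel (F : fieldType) (x y z w : F) : z != 0 -> x * y / w = x * z / w * (y / z).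
  move=> z0; rewrite mulrACA [x * z * y]mulrAC -!mulrA; congr (x * (y * _)).
  by rewrite [w^-1 * _]mulrC mulVKf.
exact: cancel.
Qed.

Lemma local_ring_frac f : exists g h,
  [/\ local_ring P g, local_ring P h, h != 0 & f = g / h].
Proof.
have [phi h ->] := class_surj hK f; have [h0 e] := class_dehomogenize h.
exists (dehomogenize phi.1), (dehomogenize phi.2).
by split=> //; apply: dehomogenize_local.
Qed.

End Chart.

Lemma local_ring_noetherian :
  noetherian_local_ring funconst (local_ring P) (local_max P).
Proof.
have [i0 hi0] := exists_coordinate; split.
- exact: local_ringC.
- exact: local_ringD.
- exact: local_ringM.
- by move=> f [phi [? ? ? ?]]; exists phi.
- exact: local_maxM.
- exact: local_max1.
- exact: local_ringV.
- exact: local_ring_residue.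
- exact: local_ring_frac hi0.
- exact: local_ring_noether hi0.
Qed.

Lemma uniformizerE t : uniformizer C P t ->
  rational_on C t /\ generates_maximal (local_ring P) (local_max P) (cl t).
Proof.
move=> [[rt zt] ht]; split=> //; split; first by apply/zero_atE.
move=> _ [phi [h1 h2 h3 ->]]; have [|psi regpsi e] := ht phi.
  by apply/zero_atE => //; exists phi.
have [rpsi _] := regpsi; exists (cl psi); first exact/regular_atE.
by rewrite (classM hK) //; apply/(class_eq hK) => //; apply: rational_mul.
Qed.

End AtPoint.


(** * Weierstrass semi-groups through valuations *)

Definition point_valuation P (v : K -> int) : Prop :=
  [/\ residual_valuation funconst v,
      forall f, local_ring P f <-> order_ge v 0 f,
      forall f, local_max P f <-> order_ge v 1 f &
      exists t, [/\ uniformizer C P t, cl t != 0 & v (cl t) = 1] ].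

Lemma class_mulX phi t m : rational_on C phi -> rational_on C t ->
  rational_on C (frac_mul phi (frac_exp t m)) /\
  cl (frac_mul phi (frac_exp t m)) = cl phi * cl t ^+ m.
Proof.
move=> h ht; have hX := rational_exp m ht; split; first exact: rational_mul.
by rewrite -classX // (classM hK).
Qed.

(** A positive element of the semi-group comes with a uniformizer, which is not
    zero since a power of it times some function is a unit. *)
Lemma weierstrass_valuation P m : C P -> (0 < m)%N ->
  weierstrass_semigroup C P m -> exists v, point_valuation P v.
Proof.
move=> CP m0 [phi [hphi _ [t [ut _ /(_ m0) nz]]]].
have [rt gt] := uniformizerE ut.
have [rX cX] := class_mulX m hphi rt.
have t0 : cl t != 0.
  apply/eqP => t0; apply: nz; apply/zero_atE => //.
  rewrite cX t0 expr0n (gtn_eqF m0) mulr0 -(mulr0 (cl t)).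
  by apply: local_maxM gt.1 _; rewrite -class0; apply: local_ringC.
have [v [hv h0 h1 vt]] := discrete_valuation (local_ring_noetherian CP) gt t0.
by exists v; split=> //; exists t.
Qed.

Section OnePlace.

Variables (P : projspace k n) (v : K -> int).
Hypotheses (CP : C P) (hv : point_valuation P v).

Lemma valuation_uniformizer t : uniformizer C P t -> cl t != 0 /\ v (cl t) = 1.
Proof.
move=> ut; have [hres h0 h1 [s [us s0 vs]]] := hv.
have [rt [Mt gt]] := uniformizerE ut.
have [_ [/gt[g /h0 Og e] _]] := uniformizerE us.
have t0 : cl t != 0 by apply: contraNneq s0 => h; rewrite e h mul0r.
have g0 : g != 0 by apply: contraNneq s0 => h; rewrite e h mulr0.
split=> //; move/h1: Mt; rewrite order_geE // => vt.
rewrite order_geE // in Og.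
by move: vs; rewrite e (valuationM hres) //; lia.
Qed.

Lemma has_pole_orderE phi m : rational_on C phi -> (0 < m)%N ->
  has_pole_order C P phi m <-> cl phi != 0 /\ v (cl phi) = - m%:Z.
Proof.
move=> hphi m0; have [hres h0 h1 [s [us s0 vs]]] := hv.
have key t : uniformizer C P t -> [/\ rational_on C t, cl t != 0 & v (cl t) = 1].
  by move=> ut; have [? _] := uniformizerE ut; have [? ?] := valuation_uniformizer ut.
split=> [[t [/key[rt t0 vt] reg /(_ m0) nz]]|[phi0 vphi]].
  have [rX cX] := class_mulX m hphi rt.
  move/(regular_atE P rX)/h0: reg; rewrite cX => reg.
  have {}nz : ~ order_ge v 1 (cl phi * cl t ^+ m).
    by move/h1; rewrite -cX => /(zero_atE P rX).
  have phi0 : cl phi != 0.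
    by apply/eqP => h; apply: nz; rewrite h mul0r /order_ge eqxx.
  split=> //; move: reg nz; rewrite !order_geE ?mulf_neq0 ?expf_neq0 //.
  by rewrite (valuationM hres) ?expf_neq0 // (valuationX hres) // vt; lia.
have [rs _] := uniformizerE us; have [rX cX] := class_mulX m hphi rs.
have vX : v (cl phi * cl s ^+ m) = 0.
  by rewrite (valuationM hres) ?expf_neq0 // (valuationX hres) // vs vphi; lia.
exists s; split=> //.
  by apply/(regular_atE P rX)/h0; rewrite cX order_geE ?mulf_neq0 ?expf_neq0 // vX.
move=> _ /(zero_atE P rX)/h1; rewrite cX order_geE ?mulf_neq0 ?expf_neq0 //.
by rewrite vX.
Qed.

End OnePlace.

Definition regular_off P P' (f : K) : Prop :=
  forall Q, C Q -> Q <> P -> Q <> P' -> local_ring Q f.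

Lemma regular_off_place_pair P P' v v' :
  point_valuation P v -> point_valuation P' v' ->
  place_pair funconst v v' (regular_off P P').
Proof.
move=> [hv _ _ _] [hv' _ _ _]; split=> //.
- by move=> x Q CQ _ _; apply: local_ringC.
- by move=> f g hf hg Q CQ h h'; apply: local_ringD; [apply: hf|apply: hg].
- by move=> f g hf hg Q CQ h h'; apply: local_ringM; [apply: hf|apply: hg].
Qed.

(** Points other than P are covered by membership in the ring of functions
    regular off P and P', together with the order at P'. *)
Lemma weierstrass_poles P P' v v' m : C P -> C P' -> P' <> P ->
  point_valuation P v -> point_valuation P' v' -> (0 < m)%N ->
  weierstrass_semigroup C P m <->
  exists f, [/\ regular_off P P' f, f != 0, order_ge v' 0 f & v f = - m%:Z].
Proof.
move=> CP CP' PP' hv hv' m0; have [_ h0 _ _] := hv'.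
split=> [[phi [hphi reg /(has_pole_orderE hv hphi m0)[phi0 vphi]]]|].
  exists (cl phi); split=> //.
    by move=> Q CQ QP _; apply/(regular_atE Q hphi); apply: reg.
  by apply/h0/(regular_atE P' hphi); apply: reg.
move=> [f [reg f0 /h0 f' vf]]; have [phi hphi fE] := class_surj hK f.
rewrite fE in reg f0 f' vf; exists phi; split=> //; last first.
  by apply/(has_pole_orderE hv hphi m0).
move=> Q CQ QP; apply/(regular_atE Q hphi).
by have [->//|QP'] := pselect (Q = P'); apply: reg.
Qed.

End FunctionFieldTheory.

Lemma embedding_dim_two_pos (H : set nat) : embedding_dim_two H ->
  exists2 m, (0 < m)%N & H m.
Proof.
case=> a [b [a2 b2 _ ->]]; exists a; first by rewrite (ltnW a2).
by exists 1%N, 0%N; rewrite muln1 muln0 addn0.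
Qed.

Theorem theorem10p1 (k : closedFieldType) (chark0 : [pchar k]%R =i pred0)
    (n : nat) (C : set (projspace k n))
    (hC : smooth_projective_curve C)
    (P P' : projspace k n) (hP : C P) (hP' : C P')
    (h : embedding_dim_two (weierstrass_semigroup C P))
    (h' : embedding_dim_two (weierstrass_semigroup C P')) :
  weierstrass_semigroup C P = weierstrass_semigroup C P'.
Proof.
have [PP'|PP'] := pselect (P = P'); first by rewrite PP'.
have irr : zariski_irreducible C by case: hC.
have [m m0 Wm] := embedding_dim_two_pos h.
have [m' m'0 Wm'] := embedding_dim_two_pos h'.
have [K [cl hK]] := function_field_exists irr.
have [v hv] := weierstrass_valuation irr hK hP m0 Wm.
have [v' hv'] := weierstrass_valuation irr hK hP' m'0 Wm'.
move: h h' => [a [b [a2 b2 co WE]]] [a' [b' [a'2 b'2 co' WE']]].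
have two (c d l : nat) : two_gen c d l%:Z <-> exists i j : nat, l = (c * i + d * j)%N.
  by split=> -[i [j e]]; exists i, j; lia.
have hS : pole_semigroup v v' (@regular_off _ _ C K cl P P') a b.
  move=> l l0; rewrite two -(weierstrass_poles hP hP' _ hv hv' l0); last by auto.
  by rewrite WE.
have hS' : pole_semigroup v' v (@regular_off _ _ C K cl P P') a' b'.
  have -> : @regular_off _ _ C K cl P P' = @regular_off _ _ C K cl P' P.
    by apply/funext => f; apply/propext; split=> hf Q CQ ? ?; apply: hf.
  move=> l l0; rewrite two -(weierstrass_poles hP' hP PP' hv' hv l0).
  by rewrite WE'.
have eqS := two_places (regular_off_place_pair hv hv') a2 b2 co a'2 b'2 co' hS hS'.
rewrite WE WE'; apply/funext => l; apply/propext.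
by split=> /two/eqS/two.
Qed.
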